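(* Let $k\ge1$ and let $G=\mathbb{Z}^k\rtimes_A\mathbb{Z}$, where $A\in GL(k,\mathbb{Z})$. Let $b$ be the number of blocks in the rational canonical form of $A$, and let $\rho_1$ be the number of distinct roots in $\mathbb{C}$ of the characteristic polynomial of the smallest block. Then $$m_n(G)\le\rho_1n^{b}+O(n^{b-1})\quad\text{for all large } n,$$ and $$m_n(G)\ge\rho_1n^{b}\quad\text{for infinitely many } n.$$
   Context: For a finitely generated group $G$, $m_n(G)$ denotes the number of maximal subgroups of $G$ of index $n$. In $\mathbb{Z}^k\rtimes_A\mathbb{Z}$ a generator of $\mathbb{Z}$ acts on $\mathbb{Z}^k$ via the matrix $A$. The rational canonical form is taken over $\mathbb{Q}$; its blocks are the companion matrices of the invariant factors $a_1\mid a_2\mid\cdots\mid a_b$ (non-units) of $A$, and the smallest block is the one corresponding to $a_1$. *)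

(* Defs.v *)
From HB Require Import structures.
From mathcomp Require Import all_boot all_order all_algebra.
From mathcomp Require Import finmap complex.
From mathcomp Require Import boolp classical_sets functions cardinality reals.

Set Implicit Arguments.
Unset Strict Implicit.
Unset Printing Implicit Defensive.

Import GRing.Theory Num.Theory.

Local Open Scope classical_set_scope.
Local Open Scope card_scope.
Local Open Scope ring_scope.

Section MaximalSubgroups.
Variable G : groupType.
Implicit Types (H K : set G) (n : nat).
Local Open Scope group_scope.

Definition is_subgroup H : Prop := group_closed [in H].

Definition left_cosets H : set (set G) :=
  [set [set g * h | h in H] | g in [set: G]].

Definition has_index H n : Prop := left_cosets H #= `I_n.

Definition is_maximal_subgroup H : Prop :=
  [/\ is_subgroup H, H <> setT
    & forall K, is_subgroup K -> H `<=` K -> K = H \/ K = setT].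

Definition maximal_subgroups n : set (set G) :=
  [set H | is_maximal_subgroup H /\ has_index H n].

(* [fset_set] of an infinite set is empty: this is a genuine count only when
   [maximal_subgroups n] is finite; see [finite_maximal_subgroups] for finitely
   generated groups and [semidirectZ_fg]. *)
Definition nb_maximal_subgroups n : nat := #|` fset_set (maximal_subgroups n)|.

Definition finitely_generated : Prop :=
  exists s : seq G, forall K, is_subgroup K -> {in s, forall x, K x} -> K = setT.

Lemma is_subgroupP H : is_subgroup H <->
  [/\ H 1, (forall x y, H x -> H y -> H (x * y)) & forall x, H x -> H x^-1].
Proof.
split=> [gH|[H1 HM HV]].
  split; first by have /set_mem := gH.1.
  - by move=> x y /mem_set Hx /mem_set Hy; apply/set_mem/(group_closedM gH).
  - by move=> x /mem_set Hx; apply/set_mem/(group_closedV gH).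
split; first exact/mem_set.
by move=> x y /set_mem Hx /set_mem Hy; apply/mem_set/HM/HV.
Qed.

Lemma left_cosetP H x y : is_subgroup H ->
  [set x * h | h in H] = [set y * h | h in H] <-> H (x^-1 * y).
Proof.
move=> /is_subgroupP[H1 HM HV]; split=> [e|Hxy].
  have : [set x * h | h in H] y by rewrite e; exists 1 => //; rewrite mulg1.
  by move=> [h Hh <-]; rewrite /= mulKg.
apply/seteqP; split=> _ [h Hh <-].
  exists ((x^-1 * y)^-1 * h); first exact/HM/Hh/HV.
  by rewrite invgM invgK -mulgA mulVKg.
by exists (x^-1 * y * h); [exact: HM | rewrite -mulgA mulVKg].
Qed.

Lemma finite_maximal_subgroups n :
  finitely_generated -> finite_set (maximal_subgroups n).
Proof.
move=> [s genG].
pose code := ({ffun 'I_(size s) -> {ffun 'I_n -> 'I_n}} * 'I_n)%type.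
pose R H (u : code) := exists c : G -> 'I_n,
  [/\ forall x y, c x = c y <-> H (x^-1 * y), forall i, exists x, c x = i,
      forall j x, u.1 j (c x) = c (s`_j * x) & u.2 = c 1].
have exR H : maximal_subgroups n H -> exists u, R H u.
  move=> [[sH _ _] /card_set_bijP[f [fI finj fsurj]]].
  pose co x := [set x * h | h in H].
  have fco x : (f (co x) < n)%N by apply: (fI (co x)); exists x.
  pose c x := Ordinal (fco x).
  have cE x y : c x = c y <-> H (x^-1 * y).
    rewrite -left_cosetP //; split=> [[]|e]; last by apply: val_inj; rewrite /= /co e.
    by apply: finj; apply/mem_set; [exists x | exists y].
  have cS i : exists x, c x = i.
    have [_ [x _ <-] fx] := fsurj i (ltn_ord i).
    by exists x; apply: val_inj.
  have [r rE] := choice cS.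
  exists ([ffun j : 'I_(size s) => [ffun i : 'I_n => c (s`_j * r i)]], c 1); exists c; split=> //.
  move=> j x; rewrite !ffunE; apply/cE.
  by rewrite invgM -mulgA mulKg; apply/cE; rewrite rE.
have injR H H' u : is_subgroup H -> is_subgroup H' -> R H u -> R H' u -> H = H'.
  move=> /is_subgroupP[H1 HM HV] /is_subgroupP[H'1 H'M H'V].
  move=> [c [cE cS cs c1]] [c' [c'E c'S c's c'1]].
  pose K := [set g | forall x y, c x = c' y -> c (g * x) = c' (g * y)].
  have KT : K = setT.
    apply: genG.
      apply/is_subgroupP; split=> [x y|g h Kg Kh x y e|g Kg x y e].
      - by rewrite !mul1g.
      - by rewrite -!mulgA; apply/Kg/Kh.
      have [z zE] := c'S (c (g^-1 * x)).
      rewrite -zE; apply/c'E; have /esym/Kg := zE.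
      by rewrite mulVKg e => /esym/c'E; rewrite invgM -mulgA.
    move=> g gs x y e.
    have jP : (index g s < size s)%N by rewrite index_mem.
    have := cs (Ordinal jP) x; have := c's (Ordinal jP) y.
    by rewrite /= nth_index // e => -> ->.
  have cc' x : c x = c' x.
    have : K x by rewrite KT.
    by move=> /(_ 1 1); rewrite !mulg1; apply; rewrite -c1 -c'1.
  have HE x : H x <-> c 1 = c x by rewrite cE invg1 mul1g.
  have H'E x : H' x <-> c' 1 = c' x by rewrite c'E invg1 mul1g.
  by apply/seteqP; split=> x; rewrite HE H'E !cc'.
have /choice[f fE] : forall H, exists u : option code,
    maximal_subgroups n H -> exists2 v, u = Some v & R H v.
  move=> H; have [/exR[v Rv]|nH] := pselect (maximal_subgroups n H).
    by exists (Some v) => _; exists v.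
  by exists None.
have /inj_card_eq/card_eqPle[_ le] : {in maximal_subgroups n &, injective f}.
  move=> H H' /set_mem mH /set_mem mH'.
  have [v -> Rv] := fE _ mH; have [w -> Rw] := fE _ mH' => -[vw].
  by rewrite -vw in Rw; apply: injR Rv Rw; [case: mH => -[] | case: mH' => -[]].
exact: card_le_finite le finite_finset.
Qed.

End MaximalSubgroups.

Section SemidirectProduct.
Variables (k : nat) (A : 'M[int]_k.+1) (uA : A \in unitmx).

Definition semidirectZ of A \in unitmx : Type := ('cV[int]_k.+1 * int)%type.
Local Notation T := (semidirectZ uA).

HB.instance Definition _ := Choice.on T.

(* (v, m) stands for v t^m, where the generator t of Z acts on column vectors
   by t v t^-1 = A v; [A ^ m] is an integer power. *)
Definition sd_one : T := (0, 0).
Definition sd_mul (x y : T) : T := (x.1 + A ^ x.2 *m y.1, x.2 + y.2).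
Definition sd_inv (x : T) : T := (- (A ^ (- x.2) *m x.1), - x.2).

Let exprD (m n : int) : A ^ (m + n) = A ^ m *m A ^ n.
Proof. by rewrite exprzDr. Qed.

Fact sd_mulA : associative sd_mul.
Proof.
by move=> x y z; rewrite /sd_mul /= mulmxDr mulmxA -exprD !addrA.
Qed.

Fact sd_mul1 : left_id sd_one sd_mul.
Proof. by case=> v m; rewrite /sd_mul /= expr0z mul1mx !add0r. Qed.

Fact sd_mulr1 : right_id sd_one sd_mul.
Proof. by case=> v m; rewrite /sd_mul /= mulmx0 !addr0. Qed.

Fact sd_mulV : left_inverse sd_one sd_inv sd_mul.
Proof. by case=> v m; rewrite /sd_mul /sd_one /= !addNr. Qed.

Fact sd_mulrV : right_inverse sd_one sd_inv sd_mul.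
Proof.
case=> v m; rewrite /sd_mul /sd_one /=.
by rewrite mulmxN mulmxA -exprD subrr expr0z mul1mx !subrr.
Qed.

HB.instance Definition _ :=
  isGroup.Build T sd_mulA sd_mul1 sd_mulr1 sd_mulV sd_mulrV.

Lemma semidirectZ_fg : finitely_generated T.
Proof.
exists ((0, 1) :: [seq (delta_mx i 0, 0) | i : 'I_k.+1]).
move=> K /is_subgroupP[K1 KMg KVg] Ks.
have KM x y : K x -> K y -> K (sd_mul x y) by exact: KMg.
have KV x : K x -> K (sd_inv x) by exact: KVg.
pose pureZ (v : 'cV[int]_k.+1) := K (v, 0).
have pD v w : pureZ v -> pureZ w -> pureZ (v + w).
  by move=> Kv /(KM _ _ Kv); rewrite /sd_mul /= expr0z mul1mx addr0.
have pN v : pureZ v -> pureZ (- v).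
  by move=> /KV; rewrite /sd_inv /= oppr0 expr0z mul1mx.
have pMn v n : pureZ v -> pureZ (v *+ n).
  by move=> Kv; elim: n => [|n IHn]; [exact: K1 | rewrite mulrS; exact: pD].
have pZ v : pureZ v.
  rewrite (matrix_sum_delta v); apply: big_ind => // i _.
  apply: big_ind => // j _; rewrite ord1.
  have Ki : pureZ (delta_mx i 0).
    by apply: Ks; rewrite inE map_f ?orbT // mem_enum.
  rewrite -[v i 0]intz scaler_int; case: (v i 0) => n; [exact: pMn | exact/pN/pMn].
have tn (n : nat) : K (0, n%:Z).
  elim: n => [|n IHn]; first exact: K1.
  have K01 : K (0, 1) by apply: Ks; rewrite inE eqxx.
  by have := KM _ _ K01 IHn; rewrite /sd_mul /= mulmx0 addr0 -intS.
have tz (z : int) : K (0, z).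
  case: z => n; first exact: tn.
  by have := KV _ (tn n.+1); rewrite /sd_inv /= mulmx0 oppr0 NegzE.
apply/seteqP; split=> // -[v z] _.
by have := KM _ _ (pZ v) (tz z); rewrite /sd_mul /= mulmx0 addr0 add0r.
Qed.

End SemidirectProduct.

(* [a] lists the invariant factors that are not units, so [a`_0] gives the
   smallest block.  [P] and [Q] have transposed rectangular types because the
   size of [D], a sum of degrees, is only propositionally equal to [n]. *)
Definition rational_canonical_form (n : nat) (M : 'M[rat]_n)
    (a : seq {poly rat}) : Prop :=
  [/\ all (fun p => p \is monic) a, all (fun p : {poly rat} => 1 < size p)%N a,
      sorted (@dvdp _) a
    & let D := \mxdiag_(i < size a) companionmx a`_i in
      exists P Q, [/\ P *m Q = 1%:M, Q *m P = 1%:M & M = P *m D *m Q]].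

(* A genuine count for p != 0, see [finite_distinct_roots]. *)
Definition nb_distinct_roots (R : realType) (p : {poly rat}) : nat :=
  #|` fset_set [set z : R[i] | root (map_poly ratr p) z]|.

Lemma finite_distinct_roots (R : realType) (p : {poly rat}) : p != 0 ->
  finite_set [set z : R[i] | root (map_poly ratr p) z].
Proof.
move=> p0; have [rs pE] := closed_field_poly_normal (map_poly ratr p : {poly R[i]}).
apply: (sub_finite_set _ (finite_seq rs)) => z /=.
by rewrite {}pE rootZ ?root_prod_XsubC // lead_coef_eq0 map_poly_eq0.
Qed.

(* Main.v *)
From HB Require Import structures.
From mathcomp Require Import all_boot all_order all_fingroup all_algebra all_field.
From mathcomp Require Import finmap complex.
From mathcomp Require Import ring zify.
From mathcomp Require Import boolp classical_sets functions cardinality reals.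
Require Import Defs.

(** Let [a_1 | ... | a_b] be the invariant factors of [A], let [G] be the semidirect
    product and [k] the rank of its normal subgroup [Z^k]. A maximal subgroup [M] of
    index [n] either contains [Z^k], and there is at most one such [M], or maps onto
    [Z]. In the second case the intersection [W] of [M] with [Z^k] is a maximal proper
    [A]-submodule of index [n], and [M] is determined by [W] together with the class
    modulo [W] of an element of height one: [n] choices for each [W].

    The submodule [W] contains [p Z^k] for a prime [p] ([maximal_prime_exponent]), and
    it is the largest submodule killed by some row vector [u] over ['F_p]
    ([translations_core]). The annihilator [f] of [u] in ['F_p[X]] is irreducible
    ([annihilator_irreducible]) and [n = p ^ d] with [d = deg f]. All nonzero vectors of
    the simple module spanned by [u] define the same [W], so [W] has [n - 1] of them, and
    double counting ([supplement_subgroups_count]) bounds [n - 1] times the number of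
    subgroups [M] by [n] times the number of nonzero [u] that are killed by [f(A)] for some
    irreducible [f] of degree [d].

    For all large [p] the rational canonical form reduces modulo [p], so the kernel of
    [f(A)] has [n ^ r] elements, where [r] is the number of reduced invariant factors
    divisible by [f] ([card_reduced_kernel]). The exponent [b] occurs only if [f] divides
    the reduction of [a_1]. As [a_1] divides a power of its radical, which has degree
    [rho_1], there are at most [rho_1] such [f]; the other [f] divide [a_b], hence they
    are bounded in number, and each contributes at most [n ^ (b - 1)]. This is the upper
    bound; the small primes are harmless, because [d <= k] bounds [n] for them.

    For the lower bound, [a_1] has [rho_1] distinct roots modulo infinitely many primes
    [p] ([infinitely_many_split_primes]). Each root [l] has [p ^ b - 1] eigenvectors [u],
    and each pair of such a [u] and a [c] in ['F_p] gives an action of [G] on the affine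
    line over ['F_p]; the stabilizer of 0 is a maximal subgroup of index [p]
    ([affine_maximal]). A subgroup arises from at most [p - 1] triples [(l, u, c)], whence
    at least [rho_1 * p * (p ^ b - 1) / (p - 1)] subgroups, and this is at least
    [rho_1 * p ^ b]. *)

Set Implicit Arguments.
Unset Strict Implicit.
Unset Printing Implicit Defensive.

Import Order.TTheory GRing.Theory Num.Theory.

Local Open Scope ring_scope.

(** * Reduction of rational numbers modulo a prime *)

Section Localization.
Variable F : fieldType.

(** The subring of [rat] on which the total function [ratr] is a ring morphism to [F];
    for [F = 'F_p] it is the localization of [Z] at [p]. *)
Definition den_unit : {pred rat} := [pred x | (denq x)%:~R != 0 :> F].

(** Writing a fraction in lowest terms only removes factors of its denominator, so a
    denominator that is nonzero in [F] stays so. *)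
Lemma ratr_frac (n d : int) : d%:~R != 0 :> F ->
  n%:Q / d%:Q \in den_unit /\ ratr (n%:Q / d%:Q) = n%:~R / d%:~R :> F.
Proof.
move=> dF; have d0 : d != 0 by apply: contraNneq dF => ->.
set x := n%:Q / d%:Q.
have dQ : d%:Q != 0 by rewrite intr_eq0.
have e : numq x * d = n * denq x.
  apply: (@intr_inj rat); rewrite !rmorphM /= numqE mulrAC /x divfK //.
have : (denq x %| d)%Z.
  rewrite -(@Gauss_dvdzr _ (numq x)); first by rewrite e dvdz_mull.
  by rewrite coprimez_sym; exact: coprime_num_den.
move=> /dvdzP[c dE].
have xF : x \in den_unit.
  by apply: contraNneq dF => h; rewrite dE rmorphM /= h mulr0.
split=> //; rewrite /ratr; apply/eqP.
by rewrite eqr_div // -!rmorphM /= e mulrC.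
Qed.

Lemma den_unitE x : x \in den_unit -> x = (numq x)%:Q / (denq x)%:Q.
Proof. by rewrite divq_num_den. Qed.

Let op2 (x y : rat) (n : int) : x \in den_unit -> y \in den_unit ->
  let z := n%:Q / (denq x * denq y)%:Q in
  z \in den_unit /\ ratr z = n%:~R / ((denq x)%:~R * (denq y)%:~R) :> F.
Proof.
move=> xF yF; have := @ratr_frac n (denq x * denq y).
by rewrite (intrM F); apply; exact: mulf_neq0.
Qed.

Let subf_div (K : fieldType) (a b c d : K) : b != 0 -> d != 0 ->
  a / b - c / d = (a * d - c * b) / (b * d).
Proof. by move=> b0 d0; rewrite -mulNr addf_div // mulNr. Qed.

Let opB x y : x \in den_unit -> y \in den_unit ->
  x - y \in den_unit /\ ratr (x - y) = ratr x - ratr y :> F.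
Proof.
move=> xF yF; have [] := op2 (numq x * denq y - numq y * denq x) xF yF.
have -> : (numq x * denq y - numq y * denq x)%:Q / (denq x * denq y)%:Q = x - y.
  rewrite [in RHS](den_unitE xF) [in RHS](den_unitE yF).
  by rewrite subf_div ?intr_eq0 ?denq_neq0 // rmorphB !rmorphM.
move=> zF zE; split=> //; rewrite zE /ratr subf_div //.
by rewrite rmorphB !rmorphM.
Qed.

Let opM x y : x \in den_unit -> y \in den_unit ->
  x * y \in den_unit /\ ratr (x * y) = ratr x * ratr y :> F.
Proof.
move=> xF yF; have [] := op2 (numq x * numq y) xF yF.
have -> : (numq x * numq y)%:Q / (denq x * denq y)%:Q = x * y.
  rewrite [in RHS](den_unitE xF) [in RHS](den_unitE yF).
  by rewrite mulf_div !rmorphM.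
by move=> zF zE; split=> //; rewrite zE /ratr mulf_div rmorphM.
Qed.

Fact den_unit_subring : subring_closed den_unit.
Proof.
split=> [|x y xF yF|x y xF yF]; first by rewrite inE (denq_int 1) oner_neq0.
- by have [] := opB xF yF.
- by have [] := opM xF yF.
Qed.

HB.instance Definition _ := GRing.isSubringClosed.Build rat den_unit
  den_unit_subring.

(** The localization as a ring of its own: reduction becomes a ring morphism, and
    polynomial or matrix identities are reduced by lifting them to this ring. *)
Record locq := Locq {locq_val : rat; locq_valP : locq_val \in den_unit}.
HB.instance Definition _ := [isSub for locq_val].
HB.instance Definition _ := [Choice of locq by <:].
HB.instance Definition _ := [SubChoice_isSubComNzRing of locq by <:].

Definition locq_red (x : locq) : F := ratr (val x).

Fact locq_red_zmod : zmod_morphism locq_red.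
Proof. by move=> x y; have [] := opB (valP x) (valP y). Qed.

Fact locq_red_monoid : monoid_morphism locq_red.
Proof.
split=> [|x y]; first by rewrite /locq_red rmorph1 -[1]/(1%:~R) ratr_int.
by have [] := opM (valP x) (valP y).
Qed.

HB.instance Definition _ := GRing.isZmodMorphism.Build locq F locq_red
  locq_red_zmod.
HB.instance Definition _ := GRing.isMonoidMorphism.Build locq F locq_red
  locq_red_monoid.

Lemma lift_mx m n (M : 'M[rat]_(m, n)) : (forall i j, M i j \in den_unit) ->
  exists2 M' : 'M[locq]_(m, n), map_mx val M' = M
    & map_mx locq_red M' = map_mx ratr M.
Proof.
move=> MF; exists (\matrix_(i, j) Locq (MF i j)); by apply/matrixP=> i j; rewrite !mxE.
Qed.

Lemma lift_poly (q : {poly rat}) : q \is a polyOver den_unit ->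
  exists2 q' : {poly locq}, map_poly val q' = q
    & map_poly locq_red q' = map_poly ratr q.
Proof.
move=> /polyOverP qF; exists (\poly_(i < size q) Locq (qF i)).
  apply/polyP=> i; rewrite coef_map coef_poly; case: ltnP => //= qi.
  by rewrite nth_default.
apply/polyP=> i; rewrite coef_map !coef_poly; case: ltnP => //= qi.
by rewrite rmorph0.
Qed.

End Localization.

Section PolynomialReduction.
Variable F : fieldType.
Local Notation den_unit := (den_unit F).
Local Notation red := (map_poly (ratr : rat -> F)).
Implicit Types q r : {poly rat}.

Lemma red_poly_val (q : {poly locq F}) : red (map_poly val q) = map_poly (@locq_red F) q.
Proof.
apply/polyP=> i; rewrite (coef_map (@locq_red F)) coef_map_id0.
  by rewrite (coef_map val).
by rewrite -[0]/(0%:~R) ratr_int.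
Qed.

Lemma red_polyM q r : q \is a polyOver den_unit -> r \is a polyOver den_unit ->
  red (q * r) = red q * red r.
Proof.
move=> /lift_poly[q' <- <-] /lift_poly[r' <- <-].
by rewrite -rmorphM /= red_poly_val rmorphM.
Qed.

Lemma red_polyD q r : q \is a polyOver den_unit -> r \is a polyOver den_unit ->
  red (q + r) = red q + red r.
Proof.
move=> /lift_poly[q' <- <-] /lift_poly[r' <- <-].
by rewrite -rmorphD /= red_poly_val rmorphD.
Qed.

Lemma red_polyB q r : q \is a polyOver den_unit -> r \is a polyOver den_unit ->
  red (q - r) = red q - red r.
Proof.
move=> /lift_poly[q' <- <-] /lift_poly[r' <- <-].
by rewrite -rmorphB /= red_poly_val rmorphB.
Qed.

Lemma red_poly_comp q r : q \is a polyOver den_unit -> r \is a polyOver den_unit ->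
  red (q \Po r) = red q \Po red r.
Proof.
move=> /lift_poly[q' <- <-] /lift_poly[r' <- <-].
by rewrite -map_comp_poly /= red_poly_val map_comp_poly.
Qed.

Lemma red_polyX q n : q \is a polyOver den_unit -> red (q ^+ n) = red q ^+ n.
Proof.
move=> /lift_poly[q' <- <-].
by rewrite -rmorphXn /= red_poly_val rmorphXn.
Qed.

Lemma red_poly1 : red 1 = 1.
Proof.
have -> : (1 : {poly rat}) = map_poly (val : locq F -> rat) 1 by rewrite rmorph1.
by rewrite red_poly_val rmorph1.
Qed.

Lemma red_poly_monic q : q \is a polyOver den_unit -> q \is monic ->
  red q \is monic /\ size (red q) = size q.
Proof.
move=> /lift_poly[q' <- <-]; have vI := val_inj : injective (val : locq F -> rat).
have sE : size (map_poly val q') = size q'.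
  by apply: size_map_inj_poly => //; exact: rmorph0.
rewrite sE monicE lead_coefE coef_map sE => /eqP e.
have e1 : q'`_(size q').-1 = 1 by apply: vI; rewrite e rmorph1.
have m : q' \is monic by rewrite monicE lead_coefE e1.
split; first exact: monic_map.
by rewrite size_map_poly_id0 // (monicP m) rmorph1 oner_neq0.
Qed.

End PolynomialReduction.

Definition for_large_primes (P : nat -> Prop) :=
  exists N, forall p, prime p -> (N < p)%N -> P p.

Lemma large_and P Q : for_large_primes P -> for_large_primes Q ->
  for_large_primes (fun p => P p /\ Q p).
Proof.
move=> [N HN] [M HM]; exists (maxn N M) => p pp; rewrite gtn_max => /andP[Np Mp].
by split; [exact: HN | exact: HM].
Qed.

Lemma large_forall (I : finType) (P : I -> nat -> Prop) :
  (forall i, for_large_primes (P i)) -> for_large_primes (fun p => forall i, P i p).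
Proof.
move=> /choice[N HN]; exists (\max_i N i) => p pp Np i; apply: HN => //.
exact: leq_ltn_trans (leq_bigmax i) Np.
Qed.

Lemma Fp_int_eq0 p (n : int) : prime p -> (n%:~R == 0 :> 'F_p) = (p %| `|n|)%N.
Proof.
move=> pp; case: n => n; first by rewrite -pmulrn -(dvdn_pcharf (pchar_Fp pp)).
by rewrite NegzE rmorphN /= oppr_eq0 -pmulrn -(dvdn_pcharf (pchar_Fp pp)).
Qed.

Lemma large_den_unit x : for_large_primes (fun p => x \in den_unit 'F_p).
Proof.
exists `|denq x|%N => p pp xp; rewrite inE Fp_int_eq0 // gtnNdvd //.
by rewrite absz_gt0 denq_neq0.
Qed.

Lemma large_polyOver (q : {poly rat}) :
  for_large_primes (fun p => q \is a polyOver (den_unit 'F_p)).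
Proof.
have [N HN] := large_forall (fun i : 'I_(size q) => large_den_unit q`_i).
exists N => p pp Np; apply/(all_nthP 0) => i iq; exact: HN pp Np (Ordinal iq).
Qed.

Lemma large_mx m n (M : 'M[rat]_(m, n)) :
  for_large_primes (fun p => forall i j, M i j \in den_unit 'F_p).
Proof. by apply: large_forall => i; apply: large_forall => j; exact: large_den_unit. Qed.

Lemma large_dvdp (q r : {poly rat}) : q %| r ->
  for_large_primes (fun p => map_poly (ratr : rat -> 'F_p) q %| map_poly ratr r).
Proof.
move=> /dvdpP[c ->].
have [N HN] := large_and (large_polyOver c) (large_polyOver q).
by exists N => p pp Np; have [? ?] := HN p pp Np; rewrite red_polyM // dvdp_mull.
Qed.

(** * Radicals and primes modulo which a polynomial splits *)

Lemma card_fset_set_seq (T : choiceType) (A : set T) (s : seq T) :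
  finite_set A -> uniq s -> (forall x, x \in s <-> A x) -> #|` fset_set A| = size s.
Proof.
move=> fA us sA; apply/perm_size/uniq_perm => // x.
by apply/idP/idP; rewrite in_fset_set // => h; [apply/sA/set_mem | apply/mem_set/sA].
Qed.

(** Up to a scalar, the product of the distinct irreducible factors. *)
Definition radical (q : {poly rat}) := q %/ gcdp q q^`().

Lemma radical_dvdp q : radical q %| q.
Proof. by rewrite divp_dvd ?dvdp_gcdl. Qed.

(** In characteristic 0 a root of multiplicity [m] of [q] has multiplicity [m - 1] in
    [q^`()], so it cannot be absorbed entirely by the gcd. *)
Lemma root_radical (C : numFieldType) (q : {poly rat}) (z : C) : q != 0 ->
  root (map_poly ratr (radical q)) z = root (map_poly ratr q) z.
Proof.
move=> q0; apply/idP/idP => [|qz].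
  rewrite -!dvdp_XsubCl => /dvdp_trans; apply; by rewrite dvdp_map radical_dvdp.
set g := gcdp q q^`(); have qE : q = radical q * g by rewrite divpK ?dvdp_gcdl.
have qC0 : map_poly ratr q != 0 :> {poly C} by rewrite map_poly_eq0.
have [m [r]] := multiplicity_XsubC (map_poly ratr q) z.
rewrite qC0 /= => rz mE; have m0 : (0 < m)%N.
  by case: m mE qz => // mE; rewrite mE mulr1 (negPf rz).
apply: contraT => sz; have : ('X - z%:P) ^+ m %| map_poly ratr g.
  rewrite -(@Gauss_dvdpr _ _ (map_poly ratr (radical q))).
    by rewrite -rmorphM -qE /= mE dvdp_mull.
  by rewrite coprimep_expl // coprimep_sym coprimep_XsubC.
have /[swap]/dvdp_trans/[apply] : map_poly ratr g %| (map_poly ratr q : {poly C})^`().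
  by rewrite deriv_map dvdp_map dvdp_gcdr.
rewrite mE.
rewrite derivM deriv_exp derivXsubC mul1r dvdp_addr; last exact: dvdp_mull.
case: m m0 {mE} => // m _; rewrite exprSr mulrnAr -mulrnAl [X in _ %| X]mulrC.
rewrite dvdp_mul2l ?expf_neq0 ?polyXsubC_eq0 // dvdp_XsubCl.
by rewrite /root hornerMn mulrn_eq0 -/(root r z) (negPf rz).
Qed.

Lemma radical_roots (C : numClosedFieldType) (q : {poly rat}) : q != 0 ->
  exists2 rs : seq C, uniq rs &
    (forall z, (z \in rs) = root (map_poly ratr q) z) /\ size (radical q) = (size rs).+1.
Proof.
move=> q0; have s0 : radical q != 0 by apply: dvdpN0 (radical_dvdp q) q0.
have [rs rE] := closed_field_poly_normal (map_poly ratr (radical q) : {poly C}).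
have lC : lead_coef (map_poly ratr (radical q) : {poly C}) != 0.
  by rewrite lead_coef_eq0 map_poly_eq0.
exists rs.
  have := make_separable q0; rewrite -(separable_map (@ratr C)) -/(radical q) rE.
  by rewrite (eqp_separable (eqp_scale _ lC)) separable_prod_XsubC.
split=> [z|]; first by rewrite -root_radical // rE rootZ // root_prod_XsubC.
by rewrite -(size_map_poly (@ratr C)) rE size_scale // size_prod_XsubC.
Qed.

Lemma nb_distinct_roots_radical (R : realType) (q : {poly rat}) : q != 0 ->
  (nb_distinct_roots R q).+1 = size (radical q).
Proof.
move=> q0; have [rs urs [rsE ->]] := @radical_roots R[i] q q0; congr _.+1.
apply: card_fset_set_seq => // [|z]; [exact: finite_distinct_roots | by rewrite rsE].
Qed.

(** Over an algebraically closed field both sides split, and every root of [q] is a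
    root of its radical. *)
Lemma dvdp_radical_exp (q : {poly rat}) : q != 0 -> q %| radical q ^+ size q.
Proof.
move=> q0; rewrite -(dvdp_map (@ratr algC)) rmorphXn /=.
have [rs rE] := closed_field_poly_normal (map_poly ratr q : {poly algC}).
have lC : lead_coef (map_poly ratr q : {poly algC}) != 0.
  by rewrite lead_coef_eq0 map_poly_eq0.
have sr : (size rs <= size q)%N.
  by rewrite -(size_map_poly (@ratr algC)) rE size_scale // size_prod_XsubC.
apply: (@dvdp_trans _ (map_poly ratr (radical q) ^+ size rs)); last exact: dvdp_exp2l.
rewrite rE dvdpZl //.
have: all (root (map_poly ratr (radical q))) rs.
  by apply/allP=> z zr; rewrite root_radical // rE rootZ // root_prod_XsubC.
elim: rs {rE sr} => [|z rs IH] /=; first by rewrite big_nil dvd1p.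
by case/andP=> z0 /IH h; rewrite big_cons exprS dvdp_mul // dvdp_XsubCl.
Qed.

(** With [c = g(0)], the value of [g] at [c N! t] is [c] times a number congruent to 1
    modulo [N!], which no prime up to [N] divides and which is a unit for finitely many
    [t] only. *)
Lemma int_poly_root_mod_primes (g : {poly int}) (N : nat) : (1 < size g)%N ->
  exists2 p, prime p /\ (N < p)%N & exists y : 'F_p, root (map_poly intr g) y.
Proof.
move=> g1; pose c := g.[0].
have rE p y : (p %| `|g.[y]|)%N -> prime p -> (N < p)%N ->
    exists2 p, prime p /\ (N < p)%N & exists y : 'F_p, root (map_poly intr g) y.
  move=> pg pp Np; exists p => //; exists y%:~R.
  by rewrite /root horner_map /= Fp_int_eq0.
have [p Np pp] := prime_above N.
have [g0|g0] := eqVneq c 0; first by apply: (rE p 0) => //; rewrite -/c g0.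
pose M : int := c * N`!%:Z.
have M0 : M != 0 by rewrite mulf_neq0 // -lt0n fact_gt0.
have /factor_theorem[q qE] : root (g - c%:P) 0 by rewrite /root !hornerE subrr.
rewrite subr0 in qE.
pose h (t : int) := 1 + N`!%:Z * t * q.[M * t].
have hE t : g.[M * t] = c * h t.
  move/eqP: qE; rewrite subr_eq => /eqP->; rewrite hornerD hornerM hornerX hornerC /h /M.
  by rewrite mulrDr mulr1 addrC [q.[_] * _]mulrC !mulrA.
have [t ht] : exists t : nat, `|h t|%N != 1%N.
  pose w := (g - c%:P) * (g + c%:P).
  have w0 : w != 0.
    have sz (e : int) : g + e%:P != 0.
      rewrite -size_poly_gt0 size_polyDl ?(leq_ltn_trans (size_polyC_leq1 _)) //.
      exact: leq_trans g1.
    by rewrite mulf_neq0 // -polyCN.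
  pose rs := [seq M * (i : nat)%:Z | i <- iota 0 (size w)].
  have : ~~ all (root w) rs.
    apply/negP => al; have := max_poly_roots w0 al.
    rewrite map_inj_uniq ?iota_uniq; last by move=> i j /(mulfI M0) [].
    by move=> /(_ isT); rewrite size_map size_iota ltnn.
  case/allPn=> _ /mapP[t _ ->]; rewrite /root /w hornerM mulf_eq0 negb_or !hornerE.
  rewrite subr_eq0 addr_eq0 hE => ht; exists t.
  apply/negP => /eqP h1; have [e|e] : h t = 1 \/ h t = -1.
  - by move: h1; case: (h t) => [[|[|]]|[|]] //; [left | right].
  - by rewrite e mulr1 eqxx in ht.
  - by rewrite e mulrN1 eqxx andbF in ht.
have [h0|h0] := eqVneq (h t) 0; first by apply: (rE p (M * t)) => //; rewrite hE h0 mulr0.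
have h1 : (1 < `|h t|)%N by rewrite ltn_neqAle eq_sym ht absz_gt0.
apply: (rE (pdiv `|h t|) (M * t)); rewrite ?pdiv_prime //.
  by rewrite hE abszM dvdn_mull // pdiv_dvd.
rewrite ltnNge; apply/negP => le.
have := pdiv_prime h1; set r := pdiv _ => rp.
have rM : (N`!%:Z * t%:Z * q.[M * t%:Z])%:~R == 0 :> 'F_r.
  by rewrite Fp_int_eq0 // !abszM -mulnA dvdn_mulr // dvdn_fact // prime_gt0.
have : (h t)%:~R == 0 :> 'F_r by rewrite Fp_int_eq0 // pdiv_dvd.
by rewrite (intrD _ 1) (eqP rM) addr0 oner_eq0.
Qed.

Lemma red_poly_int (F : fieldType) (q : {poly int}) :
  map_poly (ratr : rat -> F) (map_poly intr q) = map_poly intr q.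
Proof.
apply/polyP=> i; rewrite coef_map_id0; last by rewrite -[0]/(0%:~R) ratr_int.
by rewrite !coef_map /= ratr_int.
Qed.

Lemma rat_poly_root_mod_primes (g : {poly rat}) (N : nat) : (1 < size g)%N ->
  exists2 p, prime p /\ (N < p)%N
    & exists y : 'F_p, root (map_poly (ratr : rat -> 'F_p) g) y.
Proof.
have [q [c c0 gE]] := rat_poly_scale g => g1.
have cQ : c%:~R != 0 :> rat by rewrite intr_eq0.
have qE : map_poly intr q = map_poly intr c%:P * g.
  by rewrite gE map_polyC mul_polyC scalerA divff // scale1r.
have sq : (1 < size q)%N.
  by move: g1; rewrite gE size_scale ?invr_eq0 // size_map_inj_poly //; exact: intr_inj.
have [M HM] := large_and (large_polyOver g) (large_polyOver (map_poly intr c%:P)).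
have [p [pp Np] [y yq]] := int_poly_root_mod_primes (maxn `|c| (maxn N M)) sq.
move: Np; rewrite !gtn_max => /and3P[cp Np Mp]; exists p => //; exists y.
have [gF cF] := HM p pp Mp; move: yq; rewrite -red_poly_int qE red_polyM // red_poly_int.
rewrite rootM map_polyC rootC /= Fp_int_eq0 //.
by rewrite gtnNdvd // absz_gt0.
Qed.

(** The roots of [q] generate a number field; modulo a prime for which the minimal
    polynomial [g] of a primitive element [z] has a root [y], substituting [y] for [z]
    in the expressions of the roots of [q] gives roots of the reduction of [q], and
    they stay distinct because the Bezout relations between [g] and the differences
    of these expressions survive reduction. *)
Lemma infinitely_many_split_primes (q : {poly rat}) (N : nat) : q != 0 ->
  exists2 p, prime p /\ (N < p)%N
    & exists2 rs : seq 'F_p, uniq rs /\ (size rs).+1 = size (radical q)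
      & all (root (map_poly ratr q)) rs.
Proof.
move=> q0; have [zs uzs [zsE ->]] := @radical_roots algC q q0.
have [z _ [hs hsE]] := algC_PET zs.
have [g [_ mg gP]] := minCpolyP z.
have g1 : (1 < size g)%N.
  have := gP g; rewrite dvdpp => rg; rewrite ltnNge; apply/negP => /size1_polyC gC.
  have g0 := monic_neq0 mg; move: rg g0; rewrite gC map_polyC rootC /= fmorph_eq0.
  by move=> /eqP->; rewrite eqxx.
have shs : size zs = size hs by rewrite hsE size_map.
have divs (i : 'I_(size hs)) : g %| q \Po hs`_i.
  rewrite -gP map_comp_poly /root horner_comp -/(root _ _) -zsE hsE.
  by apply: map_f; exact: mem_nth.
have /choice[c cE] : forall i : 'I_(size hs), exists c, q \Po hs`_i = c * g.
  by move=> i; have /dvdpP[c ?] := divs i; exists c.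
(* The polynomials [hs`_i] take distinct values at [z], so [g] divides none of their
   differences. *)
have /choice[uv uvE] : forall ij : 'I_(size hs) * 'I_(size hs),
    exists uv : {poly rat} * {poly rat}, ij.1 != ij.2 ->
      uv.1 * g + uv.2 * (hs`_ij.1 - hs`_ij.2) = 1.
  case=> i j /=.
  have [->|ij] := eqVneq i j; first by exists (0, 0).
  suff /Bezout_eq1_coprimepP[uv ?] : coprimep g (hs`_i - hs`_j) by exists uv.
  rewrite /coprimep; set d := gcdp _ _.
  have /dvdpP[e gE] : d %| g by exact: dvdp_gcdl.
  have := gP g; rewrite dvdpp {1}gE rmorphM rootM /= => /orP[|dz].
    rewrite gP gE => /dvdp_leq.
    have : g != 0 by exact: monic_neq0.
    rewrite gE mulf_eq0 negb_or => /andP[e0 d0] /(_ e0).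
    rewrite size_mul // eqn_leq size_poly_gt0 d0 andbT.
    by rewrite (polySpred e0) addSn /= -addn1 leq_add2l.
  have : root (map_poly (ratr : rat -> algC) (hs`_i - hs`_j)) z.
    move: dz; rewrite !gP => /dvdp_trans; apply; exact: dvdp_gcdr.
  rewrite rmorphB /root hornerD hornerN subr_eq0 /= => /eqP e'.
  case/eqP: ij; apply: val_inj; apply/eqP.
  rewrite -(nth_uniq 0 _ _ uzs) ?shs ?ltn_ord // hsE.
  by rewrite !(nth_map 0) ?ltn_ord // e'.
have [M HM] := large_and (large_and (large_polyOver q) (large_polyOver g))
  (large_and (large_forall (fun i : 'I_(size hs) => large_polyOver hs`_i))
  (large_and (large_forall (fun i : 'I_(size hs) => large_polyOver (c i)))
  (large_and (large_forall (fun ij => large_polyOver (uv ij).1))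
             (large_forall (fun ij => large_polyOver (uv ij).2))))).
have [p [pp Np] [y yg]] := rat_poly_root_mod_primes (maxn N M) g1.
move: Np; rewrite gtn_max => /andP[Np Mp].
have [[qF gF] [hF [cF [uF vF]]]] := HM p pp Mp; exists p => //.
pose r (i : 'I_(size hs)) := (map_poly ratr hs`_i : {poly 'F_p}).[y].
exists [seq r i | i : 'I_(size hs)].
  split; last by rewrite size_map size_enum_ord shs.
  rewrite map_inj_uniq ?enum_uniq // => i j rij; apply/eqP; apply: contraT => ij.
  have := congr1 (fun w => (map_poly (ratr : rat -> 'F_p) w).[y]) (uvE (i, j) ij).
  rewrite red_polyD ?red_polyM ?red_polyB ?rpredM ?rpredB //= red_poly1 hornerD !hornerM hornerD hornerN.
  rewrite -!/(r _) rij subrr mulr0 addr0 (eqP yg) mulr0 hornerC => /eqP.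
  by rewrite eq_sym oner_eq0.
apply/allP => _ /mapP[i _ ->].
by rewrite /root -horner_comp -red_poly_comp // cE red_polyM // hornerM (eqP yg) mulr0.
Qed.

(** * Kernels of polynomials in a block companion matrix *)

Lemma row_minpoly (F : fieldType) k (A : 'M[F]_k.+1) (u : 'rV_k.+1) :
  exists2 f : {poly F}, f \is monic &
    forall g, (u *m horner_mx A g == 0) = (f %| g).
Proof.
pose P n := `[< exists2 f : {poly F}, f != 0 & u *m horner_mx A f = 0 /\ size f = n >].
have exP : exists n, P n.
  exists (size (char_poly A)); apply/asboolP; exists (char_poly A).
    exact/monic_neq0/char_poly_monic.
  by rewrite Cayley_Hamilton mulmx0.
case: (ex_minnP exP) => n /asboolP[f0 nz0 [f00 <-]] minf.
have lc : lead_coef f0 != 0 by rewrite lead_coef_eq0.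
pose f := (lead_coef f0)^-1 *: f0.
have uf : u *m horner_mx A f = 0.
  by rewrite /f linearZ /= -scalemxAr f00 scaler0.
have mf : f \is monic by rewrite monicE /f lead_coefZ mulVf.
have sf : size f = size f0 by rewrite size_scale ?invr_eq0.
have f_mul c : u *m horner_mx A (c * f) = 0.
  by rewrite mulrC rmorphM /= mulmxA uf mul0mx.
exists f => // g; apply/eqP/idP => [gu|/dvdpP[c ->]]; last exact: f_mul.
apply: contraT => ng; have /minf : P (size (g %% f)).
  apply/asboolP; exists (g %% f) => //; split=> //.
  by have := gu; rewrite {1}(divp_eq g f) rmorphD mulmxDr f_mul add0r.
by rewrite -sf leqNgt ltn_modp monic_neq0.
Qed.

(** Distinct monic irreducible polynomials are coprime, so the product of those in [L]
    divides [g]. *)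
Lemma size_irreducible_divisors (F : fieldType) (L : seq {poly F}) (g : {poly F}) :
  g != 0 -> uniq L -> {in L, forall f, [/\ f \is monic, irreducible_poly f & f %| g]} ->
  (size L <= (size g).-1)%N.
Proof.
elim: L g => // f L IH g g0 /= /andP[fL uL] H.
have [mf irf fg] : [/\ f \is monic, irreducible_poly f & f %| g] by apply: H; rewrite inE eqxx.
have [f1 _] := irf; have /dvdpP[h gE] := fg.
have h0 : h != 0 by apply: contraNneq g0 => h0; rewrite gE h0 mul0r.
have : (size L <= (size h).-1)%N.
  apply: IH => // e eL; have [me ire eg] : [/\ e \is monic, irreducible_poly e & e %| g].
    by apply: H; rewrite inE eL orbT.
  split=> //; move: eg; rewrite gE Gauss_dvdpl // irreducible_poly_coprime //.
  apply: contra fL => ef; suff <- : e = f by [].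
  by apply/eqP; rewrite -eqp_monic // irf.2 // gtn_eqF // ire.1.
rewrite gE size_mul ?(monic_neq0 mf) //= => sL.
by move: f1 sL; rewrite (polySpred h0) /=; case: (size f) => [|[|m]] // _; lia.
Qed.

Section BlockKernel.
Variables (F : finFieldType) (k b : nat) (d_ : 'I_b -> nat) (a_ : 'I_b -> {poly F}).
Variables (D_ : forall i, 'M[F]_(d_ i)).
Variables (A : 'M[F]_k.+1) (P : 'M[F]_(k.+1, \sum_i d_ i)) (Q : 'M[F]_(\sum_i d_ i, k.+1)).
Hypotheses (PQ : P *m Q = 1%:M) (QP : Q *m P = 1%:M) (AE : A = P *m (\mxdiag_i D_ i) *m Q).
Hypothesis size_a : forall i, size (a_ i) = (d_ i).+1.
Hypothesis D_mulX : forall i (w : 'rV_(d_ i)), a_ i %| 'X * rVpoly w - rVpoly (w *m D_ i).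

(** [psi u i] is the component of [u] in [F[X] / (a_ i)], where [A] acts as [X]. *)
Let psi (u : 'rV_k.+1) i : {poly F} := rVpoly (submxrow (u *m P) i).

Let psiX v i : psi (v *m A) i = rVpoly (submxrow (v *m P) i *m D_ i).
Proof.
rewrite /psi AE -!mulmxA QP mulmx1 mulmxA; congr rVpoly.
by rewrite -{1}[v *m P]submxrowK mul_mxrow_mxdiag mxrowK.
Qed.

Lemma block_horner (u : 'rV_k.+1) f i :
  a_ i %| f * psi u i - psi (u *m horner_mx A f) i.
Proof.
have psiD v w : psi (v + w) i = psi v i + psi w i.
  by rewrite /psi mulmxDl submxrowD linearD.
elim/poly_ind: f => [|f c IH].
  by rewrite mul0r rmorph0 mulmx0 /psi mul0mx submxrow0 linear0 subr0 dvdp0.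
rewrite rmorphD rmorphM /= horner_mx_X horner_mx_C mulmxDr mul_mx_scalar psiD.
have -> : psi (c *: u) i = c%:P * psi u i.
  have subZ (w : 'rV_(\sum_i d_ i)) : submxrow (c *: w) i = c *: submxrow w i.
    by apply/rowP=> j; rewrite !mxE.
  by rewrite /psi -scalemxAl subZ linearZ mul_polyC.
rewrite mulrDl opprD addrACA subrr addr0.
set v := u *m horner_mx A f in IH *.
have -> : psi (u *m (horner_mx A f * A)) i = rVpoly (submxrow (v *m P) i *m D_ i).
  by rewrite mulmxA -/v psiX.
have -> : f * 'X * psi u i - rVpoly (submxrow (v *m P) i *m D_ i) =
    'X * (f * psi u i - psi v i) + ('X * psi v i - rVpoly (submxrow (v *m P) i *m D_ i)).
  by rewrite mulrBr addrA subrK mulrA ['X * f]mulrC.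
by rewrite dvdp_add ?dvdp_mull // D_mulX.
Qed.

Lemma block_kernel (u : 'rV_k.+1) f :
  (u *m horner_mx A f == 0) = [forall i, a_ i %| f * psi u i].
Proof.
apply/eqP/forallP => [uf i|H].
  by have := block_horner u f i; rewrite uf /psi mul0mx submxrow0 linear0 subr0.
set v := u *m _; suff vP : v *m P = 0 by rewrite -[v]mulmx1 -PQ mulmxA vP mul0mx.
apply/mxrowP => i; rewrite submxrow0; apply: (can_inj (@rVpolyK _ _)).
rewrite linear0; apply/eqP; rewrite -/(psi v i); apply: contraT => nz.
have : a_ i %| psi v i.
  have := H i; rewrite -[f * _](subrK (psi v i)) dvdp_addr //; exact: block_horner.
by move=> /dvdp_leq-/(_ nz); rewrite size_a ltnNge size_poly.
Qed.

(** The kernel is the product of the [f]-torsion of the modules [F[X] / (a_ i)]: this is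
    generated by [a_ i %/ f] and isomorphic to [F[X] / (f)] if [f] divides [a_ i], and it
    is trivial otherwise, as [f] and [a_ i] are then coprime. *)
Lemma card_block_kernel f : f \is monic -> irreducible_poly f ->
  #|[set u : 'rV_k.+1 | u *m horner_mx A f == 0]| =
  (#|F| ^ ((size f).-1 * #|[pred i | (f %| a_ i)%R]|))%N.
Proof.
move=> mf irf; pose d := (size f).-1; have f1 := irf.1.
have sfE : size f = d.+1 by rewrite prednK // (ltn_trans _ f1).
pose I := [pred i | f %| a_ i].
have a0 i : a_ i != 0 by rewrite -size_poly_gt0 size_a.
(* The kernel is parametrized by the quotients of its components by [a_ i %/ f]. *)
pose lift (g : {ffun 'I_b -> 'rV[F]_d}) : 'rV_k.+1 :=
  (\mxrow_i (poly_rV (a_ i %/ f * rVpoly (g i)) : 'rV_(d_ i))) *m Q.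
have arith s e n : (s <= e)%N -> (e < n.+1)%N -> ((n.+1 - e + s).-1 <= n)%N by lia.
have arith' s e n : (s <= n)%N -> (e < n.+1)%N -> (s - (n.+1 - e).-1 <= e)%N by lia.
have size_lift g i : f %| a_ i -> (size (a_ i %/ f * rVpoly (g : 'rV[F]_d))%R <= d_ i)%N.
  move=> fa; have [->|g0] := eqVneq (rVpoly g) 0; first by rewrite mulr0 size_poly0.
  have q0 : a_ i %/ f != 0.
    by apply: contraTneq fa => q0; rewrite dvdp_eq q0 mul0r.
  rewrite size_mul // size_divp ?monic_neq0 // size_a -/d.
  have : (size (rVpoly g) <= d)%N by exact: size_poly.
  by move=> sg; apply: arith => //; have := dvdp_leq (a0 i) fa; rewrite size_a sfE.
have psi_lift g i : g \in pffun_on 0 I predT -> psi (lift g) i = a_ i %/ f * rVpoly (g i).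
  move=> /pffun_onP[/fintype.subsetP supp _].
  rewrite /psi /lift -mulmxA QP mulmx1 mxrowK poly_rV_K //.
  have [fa|nfa] := boolP (f %| a_ i); first exact: size_lift.
  have -> : g i = 0 by apply: contraNeq nfa => gi; apply: supp.
  by rewrite linear0 mulr0 size_poly0.
rewrite -/d expnM -{1}[d]mul1n -card_mx -(card_pffun_on (0 : 'rV[F]_d) I predT).
have nsupp g i : g \in pffun_on (0 : 'rV[F]_d) I predT -> ~~ (f %| a_ i) -> g i = 0.
  move=> /pffun_onP[/fintype.subsetP supp _] nfa.
  by apply: contraNeq nfa => gi; apply: supp.
have quo0 i : f %| a_ i -> a_ i %/ f != 0.
  by move=> fa; apply: contraTneq fa => q0; rewrite dvdp_eq q0 mul0r.
have aE i : f %| a_ i -> a_ i = f * (a_ i %/ f) by move=> fa; rewrite mulrC divpK.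
rewrite -(card_in_imset (f := lift)); last first.
  move=> g g' gP g'P e; apply/ffunP => i.
  have [fa|nfa] := boolP (f %| a_ i); last by rewrite !nsupp.
  apply: (can_inj (@rVpolyK _ _)); apply: (mulfI (quo0 i fa)).
  by rewrite -!psi_lift // e.
congr #|pred_of_set _|; apply/setP=> u; rewrite finset.inE block_kernel.
apply/forallP/imsetP => [H|[g gP ->] i]; last first.
  rewrite psi_lift //; have [fa|nfa] := boolP (f %| a_ i).
    by rewrite mulrA -aE // dvdp_mulr.
  by rewrite nsupp // linear0 !mulr0 dvdp0.
have psi_small i : a_ i %| psi u i -> psi u i = 0.
  by apply: contraTeq => nz; apply/negP=> /dvdp_leq-/(_ nz); rewrite size_a ltnNge size_poly.
have psi_dvd i : f %| a_ i -> a_ i %/ f %| psi u i.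
  move=> fa; have := H i; rewrite {1}aE // dvdp_mul2l //; exact: monic_neq0.
have psi_dvdN i : ~~ (f %| a_ i) -> psi u i = 0.
  move=> nfa; apply: psi_small; have := H i; rewrite Gauss_dvdpr //.
  by rewrite coprimep_sym irreducible_poly_coprime.
pose g : {ffun 'I_b -> 'rV[F]_d} :=
  [ffun i => if f %| a_ i then poly_rV (psi u i %/ (a_ i %/ f)) else 0].
have gP : g \in pffun_on (0 : 'rV[F]_d) I predT.
  apply/pffun_onP; split=> //; apply/fintype.subsetP=> i; rewrite !finset.inE ffunE.
  by case: ifP => //; rewrite eqxx.
exists g => //; rewrite -[u]mulmx1 -PQ mulmxA -[lift g]mulmx1 -PQ [RHS]mulmxA.
congr (_ *m Q); apply/mxrowP => i; apply: (can_inj (@rVpolyK _ _)).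
rewrite -/(psi _ _) -/(psi _ _) psi_lift // ffunE.
case: ifPn => [fa|nfa]; last by rewrite psi_dvdN // linear0 mulr0.
rewrite poly_rV_K; first by rewrite mulrC divpK // psi_dvd.
have [->|nz] := eqVneq (psi u i) 0; first by rewrite div0p size_poly0.
have su : (size (psi u i) <= d_ i)%N by exact: size_poly.
rewrite size_divp ?quo0 // size_divp ?monic_neq0 // size_a -/d.
by apply: arith' => //; have := dvdp_leq (a0 i) fa; rewrite size_a sfE.
Qed.
End BlockKernel.

(** Multiplication by [X] shifts the coefficients of [w], as the companion matrix of [c]
    does, except that the matrix replaces the overflowing [X ^+ d] by its remainder
    modulo [c]. *)
Lemma companion_mulX (F : fieldType) d (c : {poly F}) (D : 'M[F]_d) (w : 'rV_d) :
  (0 < d)%N -> c \is monic -> size c = d.+1 ->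
  (forall i j : 'I_d, D i j = if i == d.-1 :> nat then - c`_j else (i.+1 == j :> nat)%:R) ->
  c %| 'X * rVpoly w - rVpoly (w *m D).
Proof.
case: d => // n in D w * => _ mc sc DE.
have -> : 'X * rVpoly w - rVpoly (w *m D) = w 0 ord_max *: c.
  2: by rewrite -mul_polyC dvdp_mull.
have cn : c`_n.+1 = 1 by move: mc; rewrite monicE lead_coefE sc => /eqP.
apply/polyP=> j; rewrite coefB coefXM coefZ.
have [jn|nj] := ltnP j n.+1; last first.
  rewrite [X in _ - X]nth_default ?(leq_trans (size_poly _ _)) // subr0.
  case: j nj => // j; rewrite ltnS => nj /=; have [->|] := eqVneq j n.
    by rewrite cn mulr1 -[n in LHS]/(val (@ord_max n)) coef_rVpoly_ord.
  move=> jn; rewrite !nth_default ?mulr0 // ?sc ?(leq_trans (size_poly _ _)) //; lia.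
rewrite -[j in X in _ - X]/(val (Ordinal jn)) coef_rVpoly_ord mxE.
rewrite big_ord_recr /= DE /= eqxx mulrN opprD opprK addrA -[RHS]add0r; congr (_ + _).
apply/eqP; rewrite subr_eq0; apply/eqP.
case: j jn => [|j] jn /=.
  rewrite big1 // => i _; rewrite DE /= ltn_eqF ?mulr0 //; exact: ltn_ord.
have jn' : (j < n)%N by [].
rewrite (bigD1 (Ordinal jn')) //= big1 ?addr0 => [|i].
  rewrite DE /= ltn_eqF // eqxx mulr1.
  have -> : w 0 (widen_ord (leqnSn n) (Ordinal jn')) = w 0 (Ordinal (ltnW jn)) by congr (w _ _); exact: val_inj.
  by rewrite -coef_rVpoly_ord.
rewrite -val_eqE /= => ij; rewrite DE /= ltn_eqF ?ltn_ord // eqSS (negPf ij) mulr0 //.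
Qed.

Section ReductionMatrix.
Variable F : fieldType.
Local Notation red := (map_mx (ratr : rat -> F)).
Definition den_unit_mx m n (M : 'M[rat]_(m, n)) := forall i j, M i j \in den_unit F.

Lemma red_mx_val m n (M : 'M[locq F]_(m, n)) : red (map_mx val M) = map_mx (@locq_red F) M.
Proof. by apply/matrixP=> i j; rewrite !mxE. Qed.

Lemma red_mxM m n r (M : 'M[rat]_(m, n)) (N : 'M[rat]_(n, r)) :
  den_unit_mx M -> den_unit_mx N -> den_unit_mx (M *m N) /\ red (M *m N) = red M *m red N.
Proof.
move=> /lift_mx[M' <- <-] /lift_mx[N' <- <-].
rewrite -map_mxM red_mx_val (map_mxM (@locq_red F)); split=> // i j.
by rewrite mxE; exact: valP.
Qed.

Lemma red_mx1 n : red (1%:M : 'M_n) = 1%:M.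
Proof.
apply/matrixP=> i j; rewrite !mxE; case: eqP => _; rewrite ?mulr1n ?mulr0n.
  by rewrite -[1]/(1%:~R) ratr_int.
by rewrite -[0]/(0%:~R) ratr_int.
Qed.

Lemma red_mx_int m n (M : 'M[int]_(m, n)) : red (map_mx intr M) = map_mx intr M.
Proof. by apply/matrixP=> i j; rewrite !mxE ratr_int. Qed.

Lemma red_mxdiag b (d_ : 'I_b -> nat) (D : forall i, 'M[rat]_(d_ i)) :
  red (\mxdiag_i D i) = \mxdiag_i red (D i).
Proof.
apply/matrixP=> i j; rewrite !mxE; set c := conform_mx _ _; set e := conform_mx _ _.
have r0 : ratr 0 = 0 :> F by rewrite -[0]/(0%:~R) ratr_int.
case: ifP => _; last by rewrite !mxE r0.
have -> : e = red c by rewrite map_conform_mx; congr conform_mx; apply/matrixP=> ? ?; rewrite !mxE r0.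
by rewrite mxE.
Qed.
End ReductionMatrix.

(** A change of basis to the rational canonical form has finitely many denominators, and
    it reduces modulo every prime that divides none of them. *)
Lemma card_reduced_kernel k (A : 'M[int]_k.+1) (a : seq {poly rat}) :
  rational_canonical_form (map_mx intr A) a ->
  for_large_primes (fun p => forall f : {poly 'F_p}, f \is monic -> irreducible_poly f ->
    #|[set u : 'rV_k.+1 | u *m horner_mx (map_mx intr A) f == 0]| =
    (p ^ ((size f).-1 * #|[pred i : 'I_(size a) | (f %| map_poly ratr a`_i)%R]|))%N).
Proof.
case=> ma sa _ [P [Q [PQ QP AE]]].
set D := \mxdiag_i _ in AE.
have [N HN] := large_and (large_forall (fun i : 'I_(size a) => large_polyOver a`_i))
  (large_and (large_mx P) (large_and (large_mx Q) (large_mx D))).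
exists N => p pp Np f mf irf; have [aF [PF [QF DF]]] := HN p pp Np.
pose red m n := @map_mx _ 'F_p ratr m n.
have PQ' : red _ _ P *m red _ _ Q = 1%:M.
  by have [_ <-] := red_mxM PF QF; rewrite PQ red_mx1.
have QP' : red _ _ Q *m red _ _ P = 1%:M.
  by have [_ <-] := red_mxM QF PF; rewrite QP red_mx1.
have AE' : map_mx intr A = red _ _ P *m (\mxdiag_i red _ _ (companionmx a`_i)) *m red _ _ Q.
  have [PDF PDE] := red_mxM PF DF; have [_ PDQE] := red_mxM PDF QF.
  by rewrite -red_mx_int AE /red PDQE PDE red_mxdiag.
have mi (i : 'I_(size a)) : a`_i \is monic by exact: (all_nthP 0 ma _ (ltn_ord i)).
have si (i : 'I_(size a)) : (1 < size (a`_i)%R)%N by exact: (all_nthP 0 sa _ (ltn_ord i)).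
rewrite (card_block_kernel (a_ := fun i => map_poly ratr a`_i) PQ' QP' AE' _ _ mf irf) ?card_Fp // => [i|i w].
  have [_ ->] := red_poly_monic (aF i) (mi i); by rewrite prednK // (ltn_trans _ (si i)).
have [mri sri] := red_poly_monic (aF i) (mi i).
apply: companion_mulX => //.
- by rewrite -subn1 subn_gt0.
- by rewrite sri prednK // (ltn_trans _ (si i)).
- move=> j l; rewrite !mxE coef_map_id0; last by rewrite -[0]/(0%:~R) ratr_int.
  case: ifP => _; last by rewrite ratr_nat.
  by rewrite /ratr numqN denqN rmorphN mulNr.
Qed.

(** * Maximal subgroups of the semidirect product *)

Section Index.
Variables (G : groupType) (H : set G).
Hypothesis sH : is_subgroup H.
Local Open Scope group_scope.

(** A bijection from the left cosets of [H] to [X], given as a function on [G]. *)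
Definition coset_labelling (X : Type) (c : G -> X) :=
  (forall x y, c x = c y <-> H (x^-1 * y)) /\ (forall i, exists x, c x = i).

Lemma has_index_labelling n : has_index H n -> exists c : G -> 'I_n, coset_labelling c.
Proof.
move=> /card_set_bijP[f [fI finj fsurj]].
pose co x := [set x * h | h in H]%classic.
have fco x : (f (co x) < n)%N by apply: (fI (co x)); exists x.
exists (fun x => Ordinal (fco x)); split=> [x y|i].
  rewrite -(left_cosetP x y sH); split=> [[]|e]; last by apply: val_inj; rewrite /= /co e.
  by apply: finj; apply/mem_set; [exists x | exists y].
have [_ [x _ <-] fx] := fsurj i (ltn_ord i).
by exists x; apply: val_inj.
Qed.

Lemma labelling_has_index (X : finType) (c : G -> X) :
  coset_labelling c -> has_index H #|X|.
Proof.
move=> [cE cS].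
pose co x := [set x * h | h in H]%classic.
have coE x y : co x = co y <-> c x = c y by rewrite cE -left_cosetP.
have /choice[f fE] : forall C : set G, exists i : nat, forall x, C = co x -> i = enum_rank (c x).
  move=> C; have [[x ->]|nC] := pselect (exists x, C = co x); last first.
    by exists 0%N => x Cx; case: nC; exists x.
  by exists (enum_rank (c x)) => y /coE->.
apply/card_set_bijP; exists f; split.
- by move=> _ [x _ <-] /=; rewrite (fE _ x).
- move=> C D /set_mem[x _ <-] /set_mem[y _ <-]; rewrite (fE _ x) // (fE _ y) //.
  by move=> /val_inj/enum_rank_inj/coE.
- move=> i /= iX; have [x xE] := cS (enum_val (Ordinal iX)).
  by exists (co x); [exists x | rewrite (fE _ x) // xE enum_valK].
Qed.

Lemma labelling_card (X : finType) (c : G -> X) n :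
  coset_labelling c -> has_index H n -> n = #|X|.
Proof.
move=> /labelling_has_index; rewrite /has_index => hX hn; apply/card_eq_II.
by apply: card_eq_trans hX; rewrite card_eq_sym.
Qed.
End Index.

Section SemidirectSubgroups.
Variables (k : nat) (A : 'M[int]_k.+1) (uA : A \in unitmx).
Local Notation T := (semidirectZ uA).
Implicit Types (M H : set T) (v w : 'cV[int]_k.+1).
Local Open Scope group_scope.

Lemma sd_mulE v w (m n : int) : ((v, m) : T) * ((w, n) : T) = ((v + A ^ m *m w, m + n)%R : T).
Proof. by []. Qed.

Lemma sd_invE v (m : int) : ((v, m) : T)^-1 = ((- (A ^ (- m) *m v), - m)%R : T).
Proof. by []. Qed.

Lemma zpowD (m n : int) : (A ^ (m + n) = A ^ m *m A ^ n)%R.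
Proof. by rewrite exprzDr. Qed.

(** Negative powers of [A] are included: these are the subgroups of [Z^k] that are normal
    in the semidirect product. *)
Definition is_submodule (W : set 'cV[int]_k.+1) : Prop :=
  [/\ W 0%R, forall v w, W v -> W w -> W (v - w)%R
    & forall (m : int) v, W v -> W (A ^ m *m v)%R].

Lemma submoduleN W v : is_submodule W -> W v -> W (- v)%R.
Proof. by case=> W0 WB _ Wv; rewrite -sub0r; exact: WB. Qed.

Lemma submoduleD W v w : is_submodule W -> W v -> W w -> W (v + w)%R.
Proof. by move=> sW Wv Ww; rewrite -[w]opprK; case: (sW) => _ + _; apply=> //; exact: submoduleN. Qed.

Definition translations H : set 'cV[int]_k.+1 := [set v | H (v, 0%R)]%classic.

Section Subgroup.
Variable H : set T.
Hypothesis sH : is_subgroup H.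

Lemma subgroup_height (v : 'cV[int]_k.+1) : H (v, 1%R) ->
  forall m : int, exists w, H (w, m).
Proof.
have /is_subgroupP[H1 HM HV] := sH => Hv.
have Hn (n : nat) : exists w, H (w, n%:Z).
  elim: n => [|n [w Hw]]; first by exists 0%R.
  by have := HM _ _ Hv Hw; rewrite sd_mulE -intS; exists (v + A ^ 1 *m w)%R.
move=> [n|n] //; have [w /HV] := Hn n.+1.
by rewrite sd_invE -NegzE; eexists; eassumption.
Qed.

Lemma subgroup_sub v w m : H (v, m) -> H (w, m) -> translations H (v - w)%R.
Proof.
have /is_subgroupP[H1 HM HV] := sH => Hv /HV Hw.
have := HM _ _ Hv Hw; rewrite sd_invE sd_mulE mulmxN mulmxA -zpowD subrr.
by rewrite expr0z mul1mx.
Qed.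

Lemma subgroup_add v w m : translations H v -> H (w, m) -> H ((v + w)%R, m).
Proof.
have /is_subgroupP[H1 HM HV] := sH => Hv Hw; have := HM _ _ Hv Hw.
by rewrite sd_mulE expr0z mul1mx add0r.
Qed.

Lemma subgroup_mulr (x y : T) : H y -> H (x * y) <-> H x.
Proof.
have /is_subgroupP[H1 HM HV] := sH => Hw; split=> [h|h]; last exact: HM.
by rewrite -[x](mulgK y); apply: HM => //; exact: HV.
Qed.

Lemma subgroup_mull (x y : T) : H x -> H (x * y) <-> H y.
Proof.
have /is_subgroupP[H1 HM HV] := sH => Hw; split=> [h|h]; last exact: HM.
by rewrite -[y](mulKg x); apply: HM => //; exact: HV.
Qed.

Lemma translations_submodule (v : 'cV[int]_k.+1) : H (v, 1%R) ->
  is_submodule (translations H).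
Proof.
move=> Hv; have /is_subgroupP[H1 HM HV] := sH.
have Hh := subgroup_height Hv; split=> [|v1 v2|m u Hu]; first exact: H1.
  exact: subgroup_sub.
have [w Hw] := Hh m; have := HM _ _ Hw Hu; rewrite sd_mulE addr0 => h.
by have := subgroup_sub h Hw; rewrite addrAC subrr add0r.
Qed.

End Subgroup.

(** A subgroup mapping onto [Z] is determined by its translations and by any of its
    elements of height one: two such subgroups sharing these have an intersection
    which also maps onto [Z], so each element of one differs from an element
    of the other by a common translation. *)
Lemma subgroup_eq H H' v v' : is_subgroup H -> is_subgroup H' ->
  H (v, 1%R) -> H' (v', 1%R) -> translations H = translations H' ->
  translations H (v - v')%R -> H = H'.
Proof.
move=> sH sH' Hv H'v' e Hd.
have Hv' : H (v', 1%R).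
  rewrite -[v'](subKr v) addrC; apply: subgroup_add => //.
  exact: submoduleN (translations_submodule sH Hv) Hd.
have sI : is_subgroup (H `&` H')%classic.
  have /is_subgroupP[H1 HM HV] := sH; have /is_subgroupP[H'1 H'M H'V] := sH'.
  apply/is_subgroupP; split=> [|x y [? ?] [? ?]|x [? ?]]; split; auto.
have hI := subgroup_height sI (conj Hv' H'v').
apply/seteqP; split=> -[w m] Hw; have [u [Hu H'u]] := hI m.
  rewrite -[w](subrK u); apply: subgroup_add => //.
  by rewrite -e; exact: subgroup_sub Hw Hu.
rewrite -[w](subrK u); apply: subgroup_add => //.
by rewrite e; exact: subgroup_sub Hw H'u.
Qed.

(** The product of the translations in [W] by [H]. *)
Definition extension H (W : set 'cV[int]_k.+1) : set T :=
  [set x | exists2 w, W w & H ((x.1 - w)%R, x.2)]%classic.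

Section Extension.
Variables (H : set T) (W : set 'cV[int]_k.+1).
Hypotheses (sH : is_subgroup H) (sW : is_submodule W).

Local Notation ext := (extension H W).

Lemma extension_subgroup : is_subgroup ext.
Proof.
have /is_subgroupP[H1 HM HV] := sH; have [W0 WB WA] := sW.
have WN := submoduleN sW.
apply/is_subgroupP; split=> [|[v m] [v' m'] [w Ww Hv] [w' Ww' Hv']|[v m] [w Ww Hv]].
- by exists 0%R; rewrite //= subr0; exact: H1.
- exists (w + A ^ m *m w')%R; first by apply: submoduleD => //; exact: WA.
  have := HM _ _ Hv Hv'; rewrite /= sd_mulE; congr H; congr (_, _).
  by rewrite mulmxBr opprD addrACA.
- exists (- (A ^ (- m) *m w))%R; first by apply: WN; exact: WA.
  have := HV _ Hv; rewrite /= sd_invE; congr H; congr (_, _).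
  by rewrite mulmxBr opprB opprK addrC.
Qed.

Lemma sub_extension : (H `<=` ext)%classic.
Proof. by case=> v m Hv; have [W0 _ _] := sW; exists 0%R; rewrite //= subr0. Qed.

Lemma extension_translation w : W w -> ext (w, 0%R).
Proof.
have /is_subgroupP[H1 _ _] := sH => Ww; exists w; rewrite //= subrr; exact: H1.
Qed.
End Extension.

Section MaximalSupplement.
Variable M : set T.
Hypotheses (maxM : is_maximal_subgroup M) (nTM : ~ forall v, translations M v).

(** The product of [Z^k] by [M] is a subgroup strictly above [M], so it is everything. *)
Lemma maximal_height_one : exists v, M (v, 1%R).
Proof.
have [sM _ mM] := maxM.
have sT : is_submodule [set: _]%classic by split.
have [|e|e] := mM _ (extension_subgroup sM sT); first exact: sub_extension.
  by case: nTM => v; rewrite /translations /= -e; exact: extension_translation.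
have : [set: T]%classic (0%R, 1%R) by []; rewrite -e => -[w _ /=]; rewrite add0r.
by exists (- w)%R.
Qed.

(** The product of [W] by [M] is a subgroup above [M], so it is [M] or everything. *)
Lemma maximal_translations (W : set 'cV[int]_k.+1) : is_submodule W ->
  (translations M `<=` W)%classic -> W = translations M \/ forall v, W v.
Proof.
move=> sW MW; have [sM _ mM] := maxM.
have [|e|e] := mM _ (extension_subgroup sM sW); first exact: sub_extension.
  left; apply/seteqP; split=> // w Ww; rewrite /translations /= -e.
  exact: extension_translation.
right=> v; have : [set: T]%classic (v, 0%R) by []; rewrite -e => -[w Ww /= /MW Wv].
by have := submoduleD sW Wv Ww; rewrite subrK.
Qed.

End MaximalSupplement.
End SemidirectSubgroups.

Lemma index_pigeonhole (G : groupType) (H : set G) n (x : nat -> G) :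
  is_subgroup H -> has_index H n ->
  exists i j, [/\ (i < j)%N, (j <= n)%N & H ((x i)^-1 * x j)%g].
Proof.
move=> sH /(has_index_labelling sH)[c [cE _]].
have : ~~ injectiveb (fun i : 'I_n.+1 => c (x i)).
  by apply/injectiveP => /leq_card; rewrite !card_ord ltnn.
case/injectivePn=> i [j ij /cE Hij].
have [ji|ji|e] := ltngtP i j; last by rewrite (val_inj e) eqxx in ij.
  by exists i, j; split=> //; rewrite -ltnS.
exists j, i; split=> //; first by rewrite -ltnS.
by have /is_subgroupP[_ _ HV] := sH; have := HV _ Hij; rewrite invgM invgK.
Qed.

Section FiniteIndex.
Variables (k : nat) (A : 'M[int]_k.+1) (uA : A \in unitmx).
Local Notation T := (semidirectZ uA).
Variables (M : set T) (n : nat).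
Hypotheses (sM : is_subgroup M) (iM : has_index M n).

(** Two of the vectors [0, v, ..., v *+ n] lie in the same coset, so some [v *+ j] with
    [0 < j <= n] is in [M], and [j] divides [n`!]. *)
Lemma translations_exponent : exists2 e, (0 < e)%N & forall v, translations M (v *+ e).
Proof.
exists n`! => [|v]; first exact: fact_gt0.
have [i [j [ij jn]]] := index_pigeonhole (fun i => (v *+ i, 0) : T) sM iM.
rewrite (_ : (_ * _)%g = ((v *+ (j - i), 0) : T)); last first.
  rewrite sd_invE sd_mulE oppr0 expr0z !mul1mx addr0.
  by rewrite (mulrnBr v (ltnW ij)) addrC.
move=> h.
have /dvdnP[q ->] : (j - i %| n`!)%N.
  by rewrite dvdn_fact // subn_gt0 ij (leq_trans (leq_subr _ _)).
rewrite mulnC mulrnA; elim: q => [|q IH]; first by have /is_subgroupP[] := sM.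
rewrite mulrS; exact: subgroup_add.
Qed.

(** A subgroup containing the kernel of the projection to [Z] is the preimage of a
    subgroup of [Z], hence determined by its index. *)
Lemma sub_kernelE : (forall v, translations M v) ->
  M = [set x | (n%:Z %| x.2)%Z]%classic.
Proof.
have /is_subgroupP[M1 MM MV] := sM => MT.
have ME v m : M (v, m) <-> M (0, m).
  split=> h; last by rewrite -[v]addr0; exact: subgroup_add.
  by rewrite -[0](subrr v) addrC; apply: subgroup_add.
pose P (e : nat) := (0 < e)%N && `[< M (0, e%:Z) >].
have exP : exists e, P e.
  have [i [j [ij jn]]] := index_pigeonhole (fun i => (0, i%:Z) : T) sM iM.
  rewrite sd_invE sd_mulE ME => h; exists (j - i)%N; rewrite /P subn_gt0 ij.
  by apply/asboolP; rewrite -(subzn (ltnW ij)) addrC.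
case: (ex_minnP exP) => e /andP[e0 /asboolP Me] mine.
have Mq (q : int) : M (0, e%:Z * q).
  have Mn (q' : nat) : M (0, e%:Z * q'%:Z).
    elim: q' => [|q' IH]; first by rewrite mulr0.
    by have := MM _ _ Me IH; rewrite sd_mulE mulmx0 addr0 intS mulrDr mulr1.
  case: q => q //; have := MV _ (Mn q.+1); rewrite sd_invE mulmx0 oppr0.
  by rewrite NegzE mulrN.
have MeE v m : M (v, m) <-> (e %| m)%Z.
  rewrite ME; split=> [Mm|/dvdzP[q ->]]; last by rewrite mulrC.
  have := MM _ _ Mm (Mq (- (m %/ e)%Z)); rewrite sd_mulE mulmx0 addr0 mulrN mulrC.
  have -> : m - (m %/ e)%Z * e = (m %% e)%Z by rewrite /modz.
  have r0 : 0 <= (m %% e)%Z by rewrite modz_ge0 // -lt0n.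
  have : (m %% e)%Z < e by rewrite ltz_pmod.
  move=> rlt Mr0; apply/dvdz_mod0P; move: rlt Mr0; case: (m %% e)%Z r0 => // r _ re Mr.
  case: r re Mr => // r re Mr; have : P r.+1 by rewrite /P; apply/asboolP.
  by move/mine; rewrite leqNgt -ltz_nat re.
case: e e0 Me mine Mq MeE => // e _ Me mine Mq MeE.
have -> : n = e.+1.
  have lb : coset_labelling M (fun x : T => inord `|(x.2 %% e.+1)%Z|%N : 'I_e.+1).
    have lt_e (m : int) : (`|(m %% e.+1)%Z|%N < e.+1)%N.
      by rewrite -ltz_nat gez0_abs ?modz_ge0 // ltz_pmod.
    split=> [[v m] [w l]|i]; last first.
      exists (0, i%:Z); apply: val_inj; rewrite /= modz_small ?inordK //=.
      by rewrite ltz_nat ltn_ord.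
    rewrite sd_invE sd_mulE MeE addrC -eqz_mod_dvd /=; split=> [/(congr1 val)|/eqP->//].
    rewrite /= !inordK // => h; rewrite eq_sym.
    by rewrite -[(m %% _)%Z]gez0_abs ?modz_ge0 // h gez0_abs ?modz_ge0.
  by rewrite (labelling_card sM lb iM) card_ord.
by apply/seteqP; split=> -[v m] /=; rewrite MeE.
Qed.

End FiniteIndex.

Section MaximalExponent.
Variables (k : nat) (A : 'M[int]_k.+1) (uA : A \in unitmx).
Local Notation T := (semidirectZ uA).
Variables (M : set T) (n : nat).
Hypotheses (maxM : is_maximal_subgroup M) (iM : has_index M n).
Hypothesis nTM : ~ forall v, translations M v.

(** Let [e] be the exponent of [Z^k] modulo the translations and [p] a prime factor of
    [e]. The vectors [v] such that [v *+ (e %/ p)] is a translation form a proper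
    submodule that contains the translations and all multiples of [p]; by maximality
    it consists of translations. *)
Lemma maximal_prime_exponent : exists2 p, prime p & forall v, translations M (v *+ p).
Proof.
have [sM _ _] := maxM; have [v1 Mv1] := maximal_height_one maxM nTM.
have sW := translations_submodule sM Mv1; have [W0 WB WA] := sW.
pose P (e : nat) := (0 < e)%N && `[< forall v, translations M (v *+ e) >].
have exP : exists e, P e.
  by have [e e0 eE] := translations_exponent sM iM; exists e; rewrite /P e0; apply/asboolP.
case: (ex_minnP exP) => e /andP[e0 /asboolP We] mine.
have e1 : (1 < e)%N.
  rewrite ltn_neqAle e0 andbT eq_sym; apply/eqP => e1; apply: nTM => v.
  by have := We v; rewrite e1.
exists (pdiv e); first exact: pdiv_prime.
have /dvdnP[q qE] := pdiv_dvd e; set p := pdiv e in qE *.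
have q0 : (0 < q)%N by move: e0; rewrite qE muln_gt0 => /andP[].
have sW' : is_submodule A [set v | translations M (v *+ q)]%classic.
  split=> [|v w Wv Ww|m v Wv] /=; first by rewrite mul0rn.
    by rewrite mulrnBl; exact: WB.
  by rewrite -scaler_nat scalemxAr scaler_nat; exact: WA.
have [|e'|al] := maximal_translations maxM sW'.
- move=> v Wv /=; elim: (q) => [|i IH]; first exact: W0.
  by rewrite mulrS; exact: submoduleD sW Wv IH.
- by move=> v; rewrite -e' /= -mulrnA mulnC -qE.
- have : P q by rewrite /P q0; apply/asboolP.
  move/mine; rewrite qE leqNgt ltn_Pmulr // prime_gt1 //; exact: pdiv_prime.
Qed.
End MaximalExponent.

(** * Functionals modulo a prime *)

Lemma intmx_eq0 p m n (v : 'M[int]_(m, n)) : prime p ->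
  map_mx intr v = 0 :> 'M['F_p]_(m, n) -> exists w, v = w *+ p.
Proof.
move=> pp v0; exists (\matrix_(i, j) (v i j %/ p)%Z).
apply/matrixP=> i j; rewrite mulmxnE mxE -mulr_natr pmulrn intz divzK //.
have /matrixP/(_ i j) := v0; rewrite !mxE => /eqP.
by rewrite Fp_int_eq0.
Qed.

Definition lift_Fp p m n (v : 'M['F_p]_(m, n)) : 'M[int]_(m, n) :=
  map_mx (fun x => (nat_of_ord x)%:Z) v.

Lemma lift_FpK p m n : cancel (@lift_Fp p m n) (map_mx intr).
Proof. by move=> v; apply/matrixP=> i j; rewrite !mxE -pmulrn natr_Zp. Qed.

(** An element of a finite group has finite order, so its negative powers are among its
    nonnegative ones. *)
Lemma unitmx_zpow (F : finFieldType) k (A : 'M[F]_k.+1) (m : int) : A \in unitmx ->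
  exists j, A ^ m = A ^+ j.
Proof.
move=> uA; case: m => n; first by exists n.
pose x : {unit 'M[F]_k.+1} := FinRing.unit 'M[F]_k.+1 uA.
have xV : val (x ^+ (#[x]%g).-1)%g = A^-1.
  have /(congr1 val) : (x * x ^+ (#[x]%g).-1)%g = 1%g by rewrite -expgS prednK ?order_gt0 // expg_order.
  by rewrite /= => e; rewrite -[LHS](mulKr uA) e mulr1.
exists ((#[x]%g).-1 * n.+1)%N; rewrite -[LHS]/(A ^- n.+1) exprM -exprVn -xV.
by rewrite FinRing.val_unitX.
Qed.

Section ModP.
Variables (k : nat) (A : 'M[int]_k.+1) (uA : A \in unitmx) (p : nat).
Hypothesis p_pr : prime p.
Local Notation F := 'F_p.
Local Notation bar := (map_mx intr : 'cV[int]_k.+1 -> 'cV[F]_k.+1).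
Local Notation Ab := (map_mx intr A : 'M[F]_k.+1).

Lemma Ab_unit : Ab \in unitmx.
Proof. by rewrite unitmxE det_map_mx rmorph_unit // -unitmxE. Qed.

Lemma Ab_zpow (m : int) : map_mx intr (A ^ m) = Ab ^ m.
Proof.
case: m => n; first exact: rmorphXn.
rewrite -[A ^ _]/(A ^- n.+1) -[RHS]/(Ab ^- n.+1) -!exprVn rmorphXn /=; congr (_ ^+ _).
by rewrite rmorphV.
Qed.

(** The largest [A]-submodule of [Z^k] in the kernel of [u] modulo [p]. *)
Definition core (u : 'rV[F]_k.+1) : set 'cV[int]_k.+1 :=
  [set v | forall i, u *m Ab ^+ i *m bar v = 0]%classic.

Lemma core_submodule u : is_submodule A (core u).
Proof.
split=> [i|v w uv uw i|m v uv i]; first by rewrite map_mx0 mulmx0.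
  by rewrite map_mxB mulmxBr uv uw subrr.
have [j jE] := unitmx_zpow m Ab_unit.
have XD : Ab ^+ i *m Ab ^+ j = Ab ^+ (i + j) by rewrite exprD.
by rewrite map_mxM Ab_zpow jE mulmxA -[u *m _ *m _]mulmxA XD uv.
Qed.

Lemma core_horner u v g : core u v -> u *m horner_mx Ab g *m bar v = 0.
Proof.
move=> uv; rewrite -[g]coefK poly_def rmorph_sum /= mulmx_sumr mulmx_suml.
rewrite big1 // => i _; rewrite -mul_polyC rmorphM rmorphXn /= horner_mx_C horner_mx_X.
rewrite -[_%:M * _]/(_ *m _) mul_scalar_mx -scalemxAr -scalemxAl uv scaler0 //.
Qed.

(** Since [W] contains the kernel of reduction modulo [p], its image is a proper subspace
    of the space of column vectors over ['F_p]. *)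
Lemma exists_functional (W : set 'cV[int]_k.+1) : is_submodule A W ->
  (forall v, W (v *+ p)) -> ~ (forall v, W v) ->
  exists2 u : 'rV[F]_k.+1, u != 0 & forall v, W v -> u *m bar v = 0.
Proof.
move=> sW Wp /existsNP[v0 Wv0]; have [W0 WB _] := sW.
pose S : {set 'cV[F]_k.+1} := [set x | `[< exists2 w, W w & bar w = x >]].
have S0 : 0 \in S by rewrite finset.inE; apply/asboolP; exists 0; rewrite ?map_mx0.
have SD x y : x \in S -> y \in S -> x + y \in S.
  rewrite !finset.inE => /asboolP[v Wv <-] /asboolP[w Ww <-]; apply/asboolP.
  by exists (v + w); [exact: submoduleD sW Wv Ww | rewrite map_mxD].
have SZ c x : x \in S -> c *: x \in S.
  move=> xS; rewrite -(natr_Zp c) scaler_nat; elim: (nat_of_ord c) => // n IH.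
  by rewrite mulrS; exact: SD.
pose B : 'M[F]_k.+1 := (\sum_(x in S) <<x^T>>)%MS.
have BS (y : 'rV_k.+1) : (y <= B)%MS -> y^T \in S.
  case/sub_sumsmxP => c ->; rewrite raddf_sum /=; apply: (big_ind (fun y => y \in S)) => // x xS.
  have /sub_rVP[e ->] : (c x *m <<x^T>> <= x^T)%MS.
    by apply: submx_trans (submxMl _ _) _; rewrite genmxE.
  by rewrite linearZ /= trmxK; exact: SZ.
have nB : ~~ ((bar v0)^T <= B)%MS.
  apply/negP=> /BS; rewrite trmxK finset.inE => /asboolP[w Ww wv]; apply: Wv0.
  have [x vE] : exists x, v0 - w = x *+ p.
    by apply: intmx_eq0 => //; rewrite map_mxB wv subrr.
  by rewrite -[v0](subrK w) vE; exact: submoduleD sW (Wp x) Ww.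
have colM (y : 'rV[F]_k.+1) j : y *m col j (cokermx B) = col j (y *m cokermx B).
  by apply/matrixP=> i l; rewrite !mxE; apply: eq_bigr => ? _; rewrite !mxE.
have [j jP] : exists j, (bar v0)^T *m col j (cokermx B) != 0.
  apply/existsP; apply: contraR nB; rewrite negb_exists => /forallP H.
  rewrite submxE; apply/eqP/rowP=> j; have := H j; rewrite negbK colM => /eqP.
  by move=> /matrixP/(_ 0 0); rewrite !mxE.
exists (col j (cokermx B))^T => [|v Wv].
  by apply: contraNneq jP => /(congr1 trmx); rewrite trmxK trmx0 => ->; rewrite mulmx0.
apply: trmx_inj; rewrite trmx_mul trmxK trmx0 colM.
have /eqP-> : (bar v)^T *m cokermx B == 0.
  rewrite -submxE; apply: submx_trans (_ : <<(bar v)^T^T^T>> <= _)%MS.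
    by rewrite trmxK genmxE.
  by rewrite trmxK; apply: (sumsmx_sup (bar v)) => //; rewrite finset.inE; apply/asboolP; exists v.
by apply/matrixP=> i l; rewrite !mxE.
Qed.

End ModP.

Section Coordinates.
Variables (k : nat) (A : 'M[int]_k.+1) (uA : A \in unitmx) (p : nat).
Hypothesis p_pr : prime p.
Local Notation T := (semidirectZ uA).
Local Notation F := 'F_p.
Local Notation bar := (map_mx intr : 'cV[int]_k.+1 -> 'cV[F]_k.+1).
Local Notation core := (core A).
Local Notation Ab := (map_mx intr A : 'M[F]_k.+1).

Definition annihilator (u : 'rV[F]_k.+1) (f : {poly F}) :=
  f \is monic /\ forall g, (u *m horner_mx Ab g == 0) = (f %| g).

Section Functional.
Variables (u : 'rV[F]_k.+1) (f : {poly F}).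
Hypothesis uf : annihilator u f.
Local Notation d := (size f).-1.

(** As a map on column vectors, it identifies the quotient of [Z^k] by [core u] with the
    space ['cV_d] over ['F_p]. *)
Definition krylov : 'M[F]_(d, k.+1) := \matrix_(i < d) (u *m Ab ^+ i).

Lemma krylovE (x : 'rV_d) : x *m krylov = u *m horner_mx Ab (rVpoly x).
Proof.
rewrite mulmx_sum_row /rVpoly poly_def rmorph_sum mulmx_sumr.
apply: eq_bigr => i _; rewrite rowK -mul_polyC rmorphM rmorphXn /= horner_mx_C horner_mx_X.
rewrite -[_%:M * _]/(_ *m _) mul_scalar_mx -scalemxAr; congr (_ *: _).
by rewrite insubT //= => ?; congr (x _ _); exact: val_inj.
Qed.

Lemma krylov_eq0 (x : 'rV_d) : x *m krylov = 0 -> x = 0.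
Proof.
have [mf fE] := uf; rewrite krylovE => /eqP; rewrite fE => /dvdp_leq h.
apply: (can_inj (@rVpolyK _ _)); rewrite linear0; apply/eqP; apply: contraT => /h.
have s0 : (0 < size f)%N by rewrite size_poly_gt0 monic_neq0.
by move=> /leq_trans/(_ (size_poly _ _)); rewrite -ltnS prednK // ltnn.
Qed.

Lemma krylov_free : row_free krylov.
Proof. exact: inj_row_free krylov_eq0. Qed.

Lemma degree_annihilator : (d <= k.+1)%N.
Proof. by have := krylov_free; rewrite /row_free => /eqP <-; exact: rank_leq_col. Qed.

Lemma core_krylov v : core u v <-> krylov *m bar v = 0.
Proof.
split=> [uv|H i].
  apply/row_matrixP => i; rewrite row_mul rowK row0; exact: uv.
have [mf fE] := uf; have s0 : (0 < size f)%N by rewrite size_poly_gt0 monic_neq0.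
have -> : Ab ^+ i = horner_mx Ab 'X^i by rewrite rmorphXn /= horner_mx_X.
have uqf q : u *m horner_mx Ab (q * f) = 0 by apply/eqP; rewrite fE dvdp_mull.
rewrite (divp_eq 'X^i f) rmorphD mulmxDr uqf add0r.
rewrite -[_ %% _](poly_rV_K (d := d)); first by rewrite -krylovE -mulmxA H mulmx0.
by rewrite -ltnS prednK // ltn_modp monic_neq0.
Qed.

Lemma krylov_surj (y : 'cV_d) : exists v, krylov *m bar v = y.
Proof.
have /row_freeP[B BE] := krylov_free; exists (lift_Fp (B *m y)).
by rewrite lift_FpK mulmxA BE mul1mx.
Qed.

Lemma krylovB v w : krylov *m bar (v - w) = krylov *m bar v - krylov *m bar w.
Proof. by rewrite map_mxB mulmxBr. Qed.

(** As [M] has elements of every height, each of its left cosets meets [Z^k], so the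
    index of [M] is that of [core u] in [Z^k]. *)
Lemma core_index (M : set T) n v1 : is_subgroup M -> M (v1, 1) ->
  translations M = core u -> has_index M n -> n = (p ^ d)%N.
Proof.
move=> sM Mv1 WE iM; have /choice[w Mw] := subgroup_height sM Mv1.
have lb : coset_labelling M
    (fun x : T => krylov *m bar (x.1 + A ^ x.2 *m w (- x.2))).
  split=> [[v m] [v' m']|y]; last first.
    have [v vE] := krylov_surj (y - krylov *m bar (w 0)); exists (v, 0).
    by rewrite /= oppr0 expr0z mul1mx map_mxD mulmxDr vE subrK.
  have sE (z : 'cV[int]_k.+1) l :
      (((z, l) : T) * ((w (- l), - l) : T))%g = ((z + A ^ l *m w (- l), 0) : T).
    by rewrite sd_mulE subrr.
  have -> : M (((v, m) : T)^-1 * ((v', m') : T))%g <->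
      translations M ((v' + A ^ m' *m w (- m')) - (v + A ^ m *m w (- m))).
    set x := ((v, m) : T); set y := ((v', m') : T).
    have -> : translations M ((v' + A ^ m' *m w (- m')) - (v + A ^ m *m w (- m))) =
        M ((x * ((w (- m), - m) : T))^-1 * (y * ((w (- m'), - m') : T)))%g.
      by rewrite !sE sd_invE sd_mulE oppr0 expr0z !mul1mx addr0 addrC.
    have /is_subgroupP[_ _ MV] := sM.
    by rewrite invgM -mulgA (subgroup_mull sM _ (MV _ (Mw (- m)))) mulgA
      (subgroup_mulr sM _ (Mw (- m'))).
  rewrite WE core_krylov krylovB /=; split=> [->|/eqP]; first by rewrite subrr.
  by rewrite subr_eq0 => /eqP->.
by rewrite (labelling_card sM lb iM) card_mx card_Fp // muln1.
Qed.
End Functional.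

Section Maximal.
Variables (M : set T) (n : nat).
Hypotheses (maxM : is_maximal_subgroup M) (iM : has_index M n).
Hypothesis nTM : ~ forall v, translations M v.

(** The core of [u] contains the translations, which are a maximal submodule, and it is
    proper because [u != 0]. *)
Lemma translations_core (u : 'rV[F]_k.+1) : u != 0 -> (forall v, translations M v -> u *m bar v = 0) ->
  translations M = core u.
Proof.
move=> u0 uM; have [v1 Mv1] := maximal_height_one maxM nTM; have [sM _ _] := maxM.
have [W0 WB WA] := translations_submodule sM Mv1.
have [|e|al] := maximal_translations maxM (core_submodule uA u).
- move=> v Wv i; rewrite -mulmxA.
  have -> : Ab ^+ i *m bar v = bar (A ^ i%:Z *m v) by rewrite map_mxM Ab_zpow.
  exact/uM/WA.
- by [].
- case/eqP: u0; apply/rowP=> j; have := al (delta_mx j 0) 0%N.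
  rewrite expr0 mulmx1 map_delta_mx -colE => /matrixP/(_ 0 0).
  by rewrite !mxE.
Qed.

Section Core.
Variables (u : 'rV[F]_k.+1) (f : {poly F}).
Hypotheses (u0 : u != 0) (uM : translations M = core u) (uf : annihilator u f).

Lemma annihilator_size : (1 < size f)%N.
Proof.
have [mf fE] := uf; rewrite ltnNge; apply/negP => /size1_polyC fC.
have f0 : f`_0 != 0 by rewrite -polyC_eq0 -fC monic_neq0.
have := fE f; rewrite dvdpp fC horner_mx_C mul_mx_scalar scaler_eq0 (negPf f0).
by rewrite (negPf u0).
Qed.

Lemma maximal_index : n = (p ^ (size f).-1)%N.
Proof.
have [v1 Mv1] := maximal_height_one maxM nTM; have [sM _ _] := maxM.
exact: core_index Mv1 uM iM.
Qed.

Lemma horner_functional g : u *m horner_mx Ab g != 0 ->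
  translations M = core (u *m horner_mx Ab g).
Proof.
by move=> ug; apply: translations_core => // v; rewrite uM => /core_horner.
Qed.

Let no_degree_drop (m m' i j : nat) : (m' <= i)%N -> m.-1 = m'.-1 -> (1 < m)%N ->
  j != 1%N -> m = (i + j).-1 -> j != 0%N -> m' != 0%N -> False.
Proof. lia. Qed.

(** If [f = h * g] and [f] does not divide [g], then [u g(A)] is nonzero and has the same
    core as [u], but [h] annihilates it; as the index of [M] determines the degree of the
    annihilator, [h] has the same degree as [f]. *)
Lemma annihilator_irreducible : irreducible_poly f.
Proof.
split=> [|g sg gf]; first exact: annihilator_size.
have [mf fE] := uf; have f0 := monic_neq0 mf; have /dvdpP[h hE] := gf.
have [fg|nfg] := boolP (f %| g); first by rewrite /eqp gf.
have ug : u *m horner_mx Ab g != 0 by rewrite fE.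
have [f' mf' f'E] := row_minpoly Ab (u *m horner_mx Ab g).
have [v1 Mv1] := maximal_height_one maxM nTM; have [sM _ _] := maxM.
have := core_index (conj mf' f'E) sM Mv1 (horner_functional ug) iM.
rewrite maximal_index => /eqP; rewrite eqn_exp2l ?prime_gt1 // => /eqP dE.
have f'h : f' %| h.
  have hM : horner_mx Ab g *m horner_mx Ab h = horner_mx Ab f.
    by rewrite hE mulrC rmorphM.
  by rewrite -f'E -mulmxA hM fE.
have g0 : g != 0 by apply: contraNneq f0 => g0; rewrite hE g0 mulr0.
have h0 : h != 0 by apply: contraNneq f0 => h0; rewrite hE h0 mul0r.
have sE : size f = (size h + size g).-1 by rewrite hE size_mul.
exfalso; move: (dvdp_leq h0 f'h) dE annihilator_size sg sE (g0) (monic_neq0 mf').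
rewrite -[g == 0]size_poly_eq0 -[f' == 0]size_poly_eq0.
exact: no_degree_drop.
Qed.
End Core.
End Maximal.
End Coordinates.

(** * The upper bound *)

Lemma double_count (S : eqType) (U : finType) (s : seq S) (P : pred U)
    (r : S -> U -> bool) (m n : nat) :
  (forall x, x \in s -> m <= #|[pred u | P u && r x u]|)%N ->
  (forall u, P u -> count (r^~ u) s <= n)%N ->
  (size s * m <= n * #|P|)%N.
Proof.
move=> Hm Hn; apply: (@leq_trans (\sum_(x <- s) #|[pred u | P u && r x u]|)%N).
  rewrite -sum1_size big_distrl /= big_seq [X in (_ <= X)%N]big_seq.
  by apply: leq_sum => x xs; rewrite mul1n; exact: Hm.
under eq_bigr do rewrite -sum1_card.
rewrite -sum1_card big_distrr /= (exchange_big_dep P) /=; last by move=> x u _ /andP[].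
apply: leq_sum => u Pu; rewrite muln1; apply: leq_trans (Hn u Pu).
rewrite sum1_count; apply: sub_count => x; rewrite inE => /andP[] //.
Qed.

Lemma uniq_size_le (S : eqType) (X : finType) (s : seq S) (c : S -> X) :
  uniq s -> {in s &, injective c} -> (size s <= #|X|)%N.
Proof.
move=> us cI; rewrite -(size_map c) -(card_uniqP _) ?map_inj_in_uniq //; exact: max_card.
Qed.

Section UpperBound.
Variables (k : nat) (A : 'M[int]_k.+1) (uA : A \in unitmx) (p : nat).
Hypothesis p_pr : prime p.
Local Notation T := (semidirectZ uA).
Local Notation F := 'F_p.
Local Notation bar := (map_mx intr : 'cV[int]_k.+1 -> 'cV[F]_k.+1).
Local Notation core := (core A).
Local Notation Ab := (map_mx intr A : 'M[F]_k.+1).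

(** Such an [M] is a supplement of [Z^k] in the semidirect product, since [Z^k] and [M]
    generate it. *)
Definition supplement_subgroup n (M : set T) :=
  [/\ is_maximal_subgroup M, has_index M n & ~ forall v, translations M v].

(** The nonzero combinations of the rows of [krylov] all have the same core as [u]. *)
Lemma many_functionals n M (u : 'rV[F]_k.+1) : supplement_subgroup n M ->
  u != 0 -> translations M = core u ->
  (n.-1 <= #|[pred u' : 'rV[F]_k.+1 | (u' != 0)%R && `[< translations M = core u' >]]|)%N.
Proof.
move=> [maxM iM nTM] u0 uM; have [f mf fE] := row_minpoly Ab u.
have uf : annihilator A u f by [].
rewrite (maximal_index p_pr maxM iM nTM uM uf) -{1}(card_Fp p_pr) -[(size f).-1]mul1n -card_mx.
rewrite -(cardC1 (0 : 'rV[F]_(size f).-1)).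
have inj : injective (fun x : 'rV[F]_(size f).-1 => x *m krylov A u f).
  by apply: row_free_inj; exact: krylov_free.
rewrite -(fintype.card_image inj); apply/subset_leq_card/fintype.subsetP => _ /fintype.imageP[x x0 ->].
have xu : x *m krylov A u f != 0 by apply: contraNneq (x0 : x != 0) => /(krylov_eq0 uf)->.
rewrite !finset.inE xu; apply/asboolP; rewrite krylovE; apply: horner_functional; rewrite -?krylovE //.
Qed.

(** A subgroup with these translations is determined by the class modulo [core u] of an
    element of height one. *)
Lemma few_subgroups n (u : 'rV[F]_k.+1) (s : seq (set T)) : u != 0 -> uniq s ->
  (forall M, M \in s -> supplement_subgroup n M /\ translations M = core u) ->
  (size s <= n)%N.
Proof.
move=> u0 us Hs; have [f mf fE] := row_minpoly Ab u.
have uf : annihilator A u f by [].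
case: s us Hs => // M0 s us Hs; have [[maxM iM nTM] uM] := Hs M0 (mem_head _ _).
rewrite (maximal_index p_pr maxM iM nTM uM uf) -{1}(card_Fp p_pr) -[(size f).-1]muln1 -card_mx.
have /choice[v1 v1E] : forall M, exists v, M \in M0 :: s -> M (v, 1).
  move=> M; have [/Hs[[mM _ nM] _]|//] := boolP (M \in M0 :: s); last by exists 0.
  by have [v ?] := maximal_height_one mM nM; exists v.
apply: (uniq_size_le (c := fun M => krylov A u f *m bar (v1 M))) => // M M' Ms M's e.
have [[[sM _ _] _ _] uM1] := Hs _ Ms; have [[[sM' _ _] _ _] uM'] := Hs _ M's.
apply: (subgroup_eq sM sM' (v1E _ Ms) (v1E _ M's)); first by rewrite uM1 uM'.
by rewrite uM1 (core_krylov uf) krylovB e subrr.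
Qed.

Definition irreducible_kernel d : pred 'rV[F]_k.+1 := fun u =>
  (u != 0) && `[< exists f : {poly F},
    [/\ f \is monic, irreducible_poly f, (size f).-1 = d & u *m horner_mx Ab f = 0] >].

Lemma irreducible_kernelP n M (u : 'rV[F]_k.+1) d : supplement_subgroup n M -> n = (p ^ d)%N ->
  u != 0 -> translations M = core u -> irreducible_kernel d u.
Proof.
move=> [maxM iM nTM] nE u0 uM; rewrite /irreducible_kernel u0; apply/asboolP.
have [f mf fE] := row_minpoly Ab u; exists f; split=> //.
- exact: (annihilator_irreducible p_pr maxM iM nTM u0 uM).
- have := maximal_index p_pr maxM iM nTM uM (conj mf fE); rewrite nE => /eqP.
  by rewrite eqn_exp2l ?prime_gt1 // => /eqP.
- by apply/eqP; rewrite fE dvdpp.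
Qed.

Lemma supplement_functional n M : supplement_subgroup n M ->
  (forall v, translations M (v *+ p)) ->
  exists2 u : 'rV[F]_k.+1, u != 0 & translations M = core u.
Proof.
move=> [maxM iM nTM] Mp; have [v1 Mv1] := maximal_height_one maxM nTM.
have [sM _ _] := maxM.
have [u u0 uE] := exists_functional p_pr (translations_submodule sM Mv1) Mp nTM.
by exists u => //; exact: (translations_core maxM nTM u0 uE).
Qed.

(** Count the pairs of a subgroup [M] in [s] and a functional whose core is the set of
    translations of [M]. *)
Lemma supplement_subgroups_count d (s : seq (set T)) (n := (p ^ d)%N) : uniq s ->
  (forall M, M \in s -> supplement_subgroup n M /\ forall v, translations M (v *+ p)) ->
  (size s * n.-1 <= n * #|irreducible_kernel d|)%N.
Proof.
move=> us Hs.
have Mu M : M \in s -> exists2 u : 'rV[F]_k.+1, u != 0 & translations M = core u.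
  by move=> Ms; have [cM Mp] := Hs M Ms; exact: supplement_functional cM Mp.
have {}Hs M : M \in s -> supplement_subgroup n M by case/Hs.
apply: (double_count (r := fun M u => `[< translations M = core u >])) => [M Ms|u /andP[u0 _]].
  have [u u0 uM] := Mu M Ms; apply: leq_trans (many_functionals (Hs _ Ms) u0 uM) _.
  apply/subset_leq_card/fintype.subsetP => u'; rewrite !inE => /andP[u'0 u'M].
  rewrite u'M andbT; apply: irreducible_kernelP (Hs _ Ms) _ u'0 _ => //; exact/asboolP.
rewrite -size_filter; apply: (few_subgroups u0); first exact: filter_uniq.
by move=> M; rewrite mem_filter => /andP[/asboolP uM Ms]; split=> //; exact: Hs.
Qed.

Lemma supplement_index_degree n M : supplement_subgroup n M ->
  (forall v, translations M (v *+ p)) -> exists2 d, (0 < d <= k.+1)%N & n = (p ^ d)%N.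
Proof.
move=> cM Mp; have [u u0 uM] := supplement_functional cM Mp; have [maxM iM nTM] := cM.
have [f mf fE] := row_minpoly Ab u; have uf : annihilator A u f by [].
exists (size f).-1; last exact: (maximal_index p_pr maxM iM nTM uM uf).
by rewrite (degree_annihilator uf) andbT -subn1 subn_gt0 (annihilator_size u0 uf).
Qed.
End UpperBound.

Lemma supplement_prime_power k (A : 'M[int]_k.+1) (uA : A \in unitmx) n
    (M : set (semidirectZ uA)) : supplement_subgroup n M ->
  [/\ prime (pdiv n), forall v, translations M (v *+ pdiv n)
    & exists2 d, (d <= k.+1)%N & n = (pdiv n ^ d)%N].
Proof.
move=> cM; have [maxM iM nTM] := cM.
have [p p_pr Mp] := maximal_prime_exponent maxM iM nTM.
have [d /andP[d0 dk] nE] := supplement_index_degree p_pr cM Mp.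
have -> : pdiv n = p by case: d d0 nE {dk} => // d _ ->; rewrite pdiv_pfactor.
by split=> //; exists d.
Qed.

Lemma card_cover (S : Type) (U : finType) (s : seq S) (P : pred U) (r : S -> pred U) :
  (forall u, P u -> has (r^~ u) s) -> (#|P| <= \sum_(x <- s) #|r x|)%N.
Proof.
elim: s P => [|x s IH] P H.
  by rewrite big_nil leqn0; apply/eqP/eq_card0 => u; apply/negP => /H.
rewrite big_cons -(cardID (r x) P) leq_add //.
  by apply/subset_leq_card/fintype.subsetP => u; rewrite finset.inE => /andP[].
apply: IH => u; rewrite finset.inE => /andP[/negPf ru /H /=].
by rewrite -[r x u]/(u \in r x) ru.
Qed.

Lemma dvdp_irreducible_exp (F : fieldType) (f s : {poly F}) m :
  irreducible_poly f -> f %| s ^+ m -> f %| s.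
Proof.
move=> irf fs; apply: contraT => nfs; have [f1 _] := irf.
have co : coprimep f s by rewrite irreducible_poly_coprime.
move: fs; rewrite -[s ^+ m]mulr1 Gauss_dvdpr ?coprimep_expr // dvdp1.
by case: (size f) f1 => [|[|]].
Qed.

Section IrreducibleKernelBound.
Variables (k : nat) (A : 'M[int]_k.+1) (p : nat) (b : nat) (c : 'I_b.+1 -> {poly 'F_p}).
Variables (s : {poly 'F_p}) (m d : nat).
Hypothesis p_pr : prime p.
Hypothesis kernelE : forall f : {poly 'F_p}, f \is monic -> irreducible_poly f ->
  #|[set u : 'rV_k.+1 | u *m horner_mx (map_mx intr A) f == 0]| =
  (p ^ ((size f).-1 * #|[pred i | (f %| c i)%R]|))%N.
Hypotheses (c_max : forall i, c i %| c ord_max) (cmax0 : c ord_max != 0).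
Hypotheses (s0 : s != 0) (cs : c ord0 %| s ^+ m).
Let n := (p ^ d)%N.

Let irr_pred (f : {poly 'F_p}) := `[< [/\ f \is monic, irreducible_poly f & (size f).-1 = d] >].
Let irr : seq {poly 'F_p} :=
  filter irr_pred [seq 'X^d + rVpoly x | x : 'rV['F_p]_d].

Let irr_uniq : uniq irr.
Proof.
by rewrite filter_uniq // map_inj_uniq ?enum_uniq // => x y /addrI/(can_inj (@rVpolyK _ _)).
Qed.

Let mem_irr f : f \in irr = irr_pred f.
Proof.
rewrite mem_filter andb_idr // => /asboolP[mf irf fd].
have sf : size f = d.+1 by rewrite -fd prednK // size_poly_gt0 monic_neq0.
have szd : (size (f - 'X^d)%R <= d)%N.
  apply/leq_sizeP => j; rewrite leq_eqVlt coefB coefXn => /orP[/eqP<-|dj].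
    by move: mf; rewrite monicE lead_coefE sf /= eqxx => /eqP->; rewrite subrr.
  by rewrite gtn_eqF // subr0 nth_default // sf.
apply/mapP; exists (poly_rV (f - 'X^d)); first exact: mem_enum.
by rewrite poly_rV_K // addrC subrK.
Qed.

Let count_irr (g : {poly 'F_p}) : g != 0 -> (count [pred f | (f %| g)%R] irr <= (size g).-1)%N.
Proof.
move=> g0; rewrite -size_filter; apply: size_irreducible_divisors => //.
  exact: filter_uniq.
by move=> f; rewrite mem_filter mem_irr => /andP[fg /asboolP[mf irf _]].
Qed.

(** The dimension of the kernel of [f(A)] over [F[X] / (f)] is the number of factors
    that [f] divides: it is at most [b], unless [f] divides the first one, and zero,
    unless [f] divides the last one. *)
Let card_ker f : f \in irr ->
  (#|[pred u : 'rV_k.+1 | (u != 0)%R && (u *m horner_mx (map_mx intr A) f == 0)%R]| <=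
   (f %| c ord0)%R * (n ^ b.+1).-1 + (f %| c ord_max)%R * (n ^ b).-1)%N.
Proof.
rewrite mem_irr => /asboolP[mf irf fd]; have p0 := prime_gt0 p_pr.
have n0 : (0 < n)%N by rewrite expn_gt0 p0.
set K := [pred u | _].
have -> : #|K| = (n ^ #|[pred i | (f %| c i)%R]|).-1.
  have := kernelE mf irf; rewrite (cardsD1 0) finset.inE mul0mx eqxx fd expnM -/n => <-.
  by rewrite add1n /=; apply: eq_card => u; rewrite !finset.inE.
have mono i j : (i <= j)%N -> ((n ^ i).-1 <= (n ^ j).-1)%N.
  by move=> ij; rewrite -!subn1 leq_sub2r // leq_pexp2l.
have [f0|nf0] := boolP (f %| c ord0).
  rewrite mul1n; apply: leq_trans (leq_addr _ _); apply: mono.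
  by rewrite -[X in (_ <= X)%N]card_ord max_card.
rewrite mul0n add0n; have [fm|nfm] := boolP (f %| c ord_max).
  rewrite mul1n; apply: mono; rewrite -ltnS -[X in (_ < X)%N]card_ord.
  apply: proper_card; apply/fintype.properP; split; first exact/fintype.subsetP.
  by exists ord0.
rewrite eq_card0 // => i; apply/negbTE; apply: contra nfm => fi.
exact: dvdp_trans (c_max i).
Qed.

(** The irreducible polynomials dividing the first factor also divide [s], hence there
    are at most [deg s] of them. *)
Lemma irreducible_kernel_bound :
  (#|irreducible_kernel A (p := p) d| <=
   (size s).-1 * (n ^ b.+1).-1 + (size (c ord_max)).-1 * (n ^ b).-1)%N.
Proof.
apply: (@leq_trans (\sum_(f <- irr)
    #|[pred u : 'rV_k.+1 | (u != 0)%R && (u *m horner_mx (map_mx intr A) f == 0)%R]|)%N).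
  apply: card_cover => u /andP[u0 /asboolP[f [mf irf fd uf]]].
  apply/hasP; exists f; first by rewrite mem_irr; apply/asboolP.
  by rewrite /= u0 uf eqxx.
apply: (@leq_trans (\sum_(f <- irr)
   ((f %| c ord0)%R * (n ^ b.+1).-1 + (f %| c ord_max)%R * (n ^ b).-1))%N).
  by rewrite big_seq [X in (_ <= X)%N]big_seq; apply: leq_sum => f; exact: card_ker.
rewrite big_split /= -!big_distrl /=.
have cE (g : {poly 'F_p}) : (\sum_(f <- irr) (f %| g)%R)%N = count [pred f | (f %| g)%R] irr.
  by rewrite -sum1_count [in RHS]big_mkcond; apply: eq_bigr => f _ /=; case: ifP.
rewrite !cE leq_add // leq_mul2r; first last.
  by rewrite count_irr ?orbT.
rewrite (leq_trans _ (count_irr s0)) ?orbT //.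
rewrite -!size_filter; apply: uniq_leq_size; first exact: filter_uniq.
move=> f; rewrite mem_filter => /andP[fc fi]; rewrite mem_filter fi andbT /=.
move: fi; rewrite mem_irr => /asboolP[_ irf _].
exact: dvdp_irreducible_exp irf (dvdp_trans fc cs).
Qed.
End IrreducibleKernelBound.

(** Divide by [n - 1] and use that [n * (1 + n + ... + n ^ (b - 1)) <= 2 * n ^ b]. *)
Lemma geometric_bound (n b t rho K : nat) : (1 < n)%N ->
  (t * n.-1 <= n * (rho * (n ^ b.+1).-1 + K * (n ^ b).-1))%N ->
  (t <= rho * n ^ b.+1 + (rho.*2 + K.*2) * n ^ b)%N.
Proof.
move=> n1 H; have n0 : (0 < n.-1)%N by rewrite -subn1 subn_gt0.
pose S := (\sum_(i < b) n ^ i)%N.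
have SE : (n.-1 * S = (n ^ b).-1)%N by rewrite predn_exp.
have SE' : (n.-1 * (n ^ b + S) = (n ^ b.+1).-1)%N.
  by rewrite predn_exp big_ord_recr /= addnC.
have nS : (n * S <= (n ^ b).*2)%N.
  apply: (@leq_trans ((n.-1).*2 * S)%N).
    by rewrite leq_mul2r; apply/orP; right; move: n1; case: (n) => [|[|n']] //= _; lia.
  by rewrite -doubleMl SE leq_double leq_pred.
have {H} : (t <= n * (rho * (n ^ b + S) + K * S))%N.
  rewrite -(leq_pmul2r n0); apply: leq_trans H _; rewrite -SE -SE'.
  by move: (n.-1) (n ^ b)%N => m x; apply/eq_leq; ring.
move=> /leq_trans; apply; rewrite expnS.
move: nS; rewrite -!muln2; move: (n ^ b)%N => x nS.
have -> : (n * (rho * (x + S) + K * S) = rho * (n * x) + (rho + K) * (n * S))%N by ring.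
rewrite leq_add2l -mulnDl -mulnA leq_mul2l (mulnC 2) nS orbT //.
Qed.

Section Upper.
Variables (R : realType) (k : nat) (A : 'M[int]_k.+1) (uA : A \in unitmx).
Variables (a : seq {poly rat}) (ha : rational_canonical_form (map_mx intr A) a).
Local Notation T := (semidirectZ uA).

Lemma invariant_factors_nonempty : (0 < size a)%N.
Proof.
case: ha => _ _ _; case: a => // -[P [Q [PQ _ _]]].
have /matrixP/(_ 0 0) := PQ; rewrite !mxE big1 => [/eqP|i _]; first by rewrite eq_sym oner_eq0.
by exfalso; case: i => i; rewrite big_ord0.
Qed.

Lemma invariant_factor_monic i : (i < size a)%N -> a`_i \is monic.
Proof. by case: ha => ma _ _ _ ia; exact: (all_nthP 0 ma). Qed.

Lemma invariant_factor_dvdp i j : (i <= j < size a)%N -> a`_i %| a`_j.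
Proof.
case: ha => _ _ sa _ /andP[ij ja].
apply: (sorted_leq_nth (@dvdp_trans _) (@dvdpp _) 0 sa) => //; rewrite inE //.
exact: leq_ltn_trans ij ja.
Qed.

Lemma nb_maximal_seq n : exists2 s : seq (set T), uniq s /\ size s = nb_maximal_subgroups T n
  & forall M, M \in s <-> maximal_subgroups n M.
Proof.
have fM := finite_maximal_subgroups n (semidirectZ_fg uA).
exists (fset_set (maximal_subgroups n : set (set T))); first by split; first exact: fset_uniq.
by move=> M; rewrite in_fset_set //; split=> [/set_mem|/mem_set].
Qed.

(** The maximal subgroups that contain [Z^k] are equal, by [sub_kernelE]. *)
Lemma nb_maximal_supplement n : exists2 s : seq (set T),
  uniq s /\ (forall M, M \in s -> supplement_subgroup n M)
  & (nb_maximal_subgroups T n <= 1 + size s)%N.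
Proof.
have [s [us <-] sE] := nb_maximal_seq n.
pose P (M : set T) := `[< forall v, translations M v >].
exists (filter (predC P) s).
  split=> [|M]; first exact: filter_uniq.
  by rewrite mem_filter => /andP[/asboolPn nM /sE[mM iM]].
rewrite -(count_predC P s) -!size_filter leq_add2r.
have : uniq (filter P s) by exact: filter_uniq.
have : forall M, M \in filter P s -> M = [set x | (n%:Z %| x.2)%Z]%classic.
  by move=> M; rewrite mem_filter => /andP[/asboolP nM /sE[[sM _ _] iM]]; exact: sub_kernelE.
case: (filter P s) => [|M [|M' s']] // H.
have M's : M' \in [:: M, M' & s'] by rewrite in_cons mem_head orbT.
have e : M = M' := etrans (H M (mem_head _ _)) (esym (H M' M's)).
by rewrite e cons_uniq mem_head.
Qed.

Let rho := nb_distinct_roots R (char_poly (companionmx a`_0)).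

Lemma rho_radical : rho.+1 = size (radical a`_0).
Proof.
have m0 := invariant_factor_monic invariant_factors_nonempty.
by rewrite /rho companionmxK // nb_distinct_roots_radical // monic_neq0.
Qed.

(** Small primes need no count: a supplement of index [p ^ d] has [d <= k.+1], so its
    index is bounded if [p] is. *)
Lemma upper_bound : exists C N : nat, forall n, (N <= n)%N ->
  (nb_maximal_subgroups T n <= rho * n ^ size a + C * n ^ (size a - 1))%N.
Proof.
have a0 := invariant_factors_nonempty; pose b := (size a).-1.
have bE : size a = b.+1 by rewrite prednK.
have b_lt : (b < size a)%N by rewrite bE.
pose K := (size a`_b).-1; exists (rho.*2 + K.*2 + 1)%N.
pose s := radical a`_0.
have dvd_last (i : 'I_(size a)) : a`_i %| a`_b.
  by apply: invariant_factor_dvdp; rewrite -ltnS -bE ltn_ord bE leqnn.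
have [N0 HN] := large_and (card_reduced_kernel ha)
 (large_and (large_polyOver a`_0) (large_and (large_polyOver s) (large_and (large_polyOver a`_b)
 (large_and (large_forall (fun i : 'I_(size a) => large_dvdp (dvd_last i)))
 (large_and (large_dvdp (radical_dvdp a`_0))
   (large_dvdp (dvdp_radical_exp (monic_neq0 (invariant_factor_monic a0))))))))).
(* Beyond [N0 ^ k.+1], a power of exponent at most [k.+1] has its base beyond [N0]. *)
exists (maxn 2 (N0 ^ k.+1).+1) => n; rewrite geq_max => /andP[n1 nN].
have [r [ur Hr] le_r] := nb_maximal_supplement n; apply: leq_trans le_r _.
have pb : (0 < n ^ b)%N by rewrite expn_gt0 (ltnW n1).
suff : (size r <= rho * n ^ b.+1 + (rho.*2 + K.*2) * n ^ b)%N.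
  rewrite bE subn1 /= => h; rewrite mulnDl mul1n addnC addnA leq_add //.
have [->//|[M Mr]] : r = [::] \/ exists M, M \in r.
  by case: (r) => [|M r']; [left | right; exists M; exact: mem_head].
have [p_pr Mp [d dk nE]] := supplement_prime_power (Hr M Mr).
set p := pdiv n in p_pr Mp nE.
have pN : (N0 < p)%N.
  rewrite ltnNge; apply: contraL nN => pN; rewrite -leqNgt nE.
  apply: (@leq_trans (p ^ k.+1)); first by rewrite leq_pexp2l ?prime_gt0.
  by rewrite leq_exp2r.
have [KC [a0F [sF [abF [chain [sa as_]]]]]] := HN p p_pr pN.
rewrite bE in KC chain.
have [ma0 _] := red_poly_monic a0F (invariant_factor_monic a0).
have [mab sab] := red_poly_monic abF (invariant_factor_monic b_lt).
have s0 : map_poly (ratr : rat -> 'F_p) s != 0 by apply: dvdpN0 sa (monic_neq0 ma0).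
have as' : map_poly (ratr : rat -> 'F_p) a`_0 %| map_poly ratr s ^+ size a`_0.
  by rewrite -red_polyX.
have := irreducible_kernel_bound (c := fun i : 'I_b.+1 => map_poly (ratr : rat -> 'F_p) a`_i)
  d p_pr KC chain (monic_neq0 mab) s0 as'.
rewrite -nE => bound; apply: geometric_bound => //.
have := supplement_subgroups_count p_pr (d := d) ur.
rewrite -nE => h; apply: leq_trans (h _) _.
  move=> M' M'r; split; first exact: Hr.
  by have [_ ? _] := supplement_prime_power (Hr M' M'r).
rewrite leq_mul2l; apply/orP; right; apply: leq_trans bound _.
rewrite leq_add // leq_mul2r; apply/orP; right.
  by rewrite -ltnS rho_radical -/s prednK ?size_poly_gt0 // size_poly.
by rewrite sab.
Qed.
End Upper.

(** * The lower bound *)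

Section Cocycle.
Variables (F : fieldType) (l c : F).
Hypothesis l0 : l != 0.

(** The sum [c * (1 + l + ... + l ^ (m - 1))], extended to negative [m]. *)
Definition cocycle (m : int) : F :=
  if l == 1 then c * m%:~R else c * (l ^ m - 1) / (l - 1).

Lemma cocycleD m n : cocycle (m + n) = cocycle m + l ^ m * cocycle n.
Proof.
rewrite /cocycle; case: eqVneq => [->|l1].
  by rewrite exp1rz mul1r intrD mulrDr.
rewrite expfzDr // !mulrA -mulrDl; congr (_ / _); ring.
Qed.

Lemma cocycle0 : cocycle 0 = 0.
Proof. by rewrite /cocycle expr0z subrr !mulr0 mul0r if_same. Qed.

Lemma cocycle1 : cocycle 1 = c.
Proof.
rewrite /cocycle; case: eqVneq => [_|l1]; first by rewrite mulr1.
by rewrite expr1z mulfK // subr_eq0.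
Qed.
End Cocycle.

Section Eigen.
Variables (k : nat) (A : 'M[int]_k.+1) (uA : A \in unitmx) (p : nat).
Hypothesis p_pr : prime p.
Local Notation T := (semidirectZ uA).
Local Notation F := 'F_p.
Local Notation bar := (map_mx intr : 'cV[int]_k.+1 -> 'cV[F]_k.+1).
Local Notation Ab := (map_mx intr A : 'M[F]_k.+1).

Lemma functional_surj (u : 'rV[F]_k.+1) (y : F) : u != 0 -> exists v, (u *m bar v) 0 0 = y.
Proof.
move=> /rV0Pn[j uj].
exists (lift_Fp ((y / u 0 j) *: delta_mx j 0)).
by rewrite lift_FpK -scalemxAr -colE !mxE mulfVK.
Qed.

Section Subgroup.
Variables (l c : F) (u : 'rV[F]_k.+1).
Hypotheses (u0 : u != 0) (ul : u *m Ab = l *: u).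

Lemma eigenvalue_neq0 : l != 0.
Proof.
apply: contraNneq u0 => l0; move: ul; rewrite l0 scale0r => uAb.
by rewrite -[u](mulmxK (Ab_unit uA p)) uAb mul0mx.
Qed.

Lemma eigen_zpow (m : int) v : (u *m bar (A ^ m *m v)) 0 0 = l ^ m * (u *m bar v) 0 0.
Proof.
have un (n : nat) (w : 'cV[int]_k.+1) : u *m bar (A ^+ n *m w) = l ^+ n *: (u *m bar w).
  elim: n w => [|n IH] w; first by rewrite !expr0 mul1mx scale1r.
  rewrite exprSr -[A ^+ n * A]/(A ^+ n *m A) -mulmxA IH map_mxM mulmxA ul.
  by rewrite -scalemxAl scalerA exprSr.
case: m => n; first by rewrite un mxE.
have e : A ^+ n.+1 *m (A ^ (Negz n) *m v) = v.
  by rewrite mulmxA -[A ^+ _]/(A ^ n.+1%:Z) -(zpowD uA) NegzE addrN expr0z mul1mx.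
have := un n.+1 (A ^ Negz n *m v); rewrite e => ->; rewrite [X in _ * X]mxE.
by rewrite mulrA -[l ^ Negz n]/((l ^+ n.+1)^-1) mulVf ?mul1r // expf_neq0 ?eigenvalue_neq0.
Qed.

(** Let [v] act on the line [F] by [y |-> y + u v] and the generator of [Z] by
    [y |-> l y + c]; this is an action of the semidirect product because [u] is an
    eigenvector. Then [affine_form x] is the image of 0 under [x], and
    [affine_subgroup] is the stabilizer of 0. *)
Definition affine_form (x : T) : F := (u *m bar x.1) 0 0 + cocycle l c x.2.

Definition affine_subgroup : set T := [set x | affine_form x = 0]%classic.

Lemma affine_formM (x y : T) : affine_form (x * y)%g = affine_form x + l ^ x.2 * affine_form y.
Proof.
case: x y => v m [w n]; rewrite sd_mulE /affine_form /= map_mxD mulmxDr mxE eigen_zpow.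
by rewrite cocycleD ?eigenvalue_neq0 // mulrDr addrACA.
Qed.

Lemma affine_form1 : affine_form 1%g = 0.
Proof. by rewrite /affine_form map_mx0 mulmx0 mxE cocycle0 addr0. Qed.

Lemma affine_is_subgroup : is_subgroup affine_subgroup.
Proof.
apply/is_subgroupP; rewrite /affine_subgroup; split=> [|x y /= x0 y0|x /= x0]; first exact: affine_form1.
  by rewrite affine_formM x0 y0 mulr0 addr0.
have := affine_formM x^-1%g x; rewrite mulVg affine_form1 x0 mulr0 addr0 => e.
by rewrite -e.
Qed.

Lemma affine_labelling : coset_labelling affine_subgroup affine_form.
Proof.
split=> [x y|z].
  have := affine_formM x (x^-1 * y)%g; rewrite mulKVg => ->.
  rewrite /affine_subgroup /=; split=> [/eqP|->]; last by rewrite mulr0 addr0.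
  rewrite -[X in X == _]addr0 (inj_eq (addrI _)) eq_sym mulf_eq0 expfz_eq0.
  by rewrite (negPf eigenvalue_neq0) andbF => /eqP.
have [v vz] := functional_surj z u0; exists (v, 0).
by rewrite /affine_form vz cocycle0 addr0.
Qed.

(** A subgroup strictly above the stabilizer contains a vector [w] that moves 0, and the
    multiples of [w] act transitively on the line. *)
Lemma affine_maximal : maximal_subgroups p affine_subgroup.
Proof.
have sM := affine_is_subgroup; have lb := affine_labelling.
split; last by have := labelling_has_index sM lb; rewrite card_Fp.
split=> // [e|K sK MK].
  have [v v1] := functional_surj 1 u0; have : [set: T]%classic ((v, 0) : T) by [].
  rewrite -e /affine_subgroup /= /affine_form v1 cocycle0 addr0 => /eqP.
  by rewrite oner_eq0.
have [KM|nKM] := pselect (K `<=` affine_subgroup)%classic; first by left; apply/seteqP.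
right; have /existsNP[g /not_implyP[Kg gM]] := nKM; apply/seteqP; split=> // h _.
have /is_subgroupP[K1 KMl KV] := sK.
have [z zE] := functional_surj (- cocycle l c (- g.2)) u0.
have Mz : affine_subgroup (z, - g.2) by rewrite /affine_subgroup /= /affine_form zE addNr.
pose w := g.1 + A ^ g.2 *m z.
have Kw : translations K w.
  have := KMl _ _ Kg (MK _ Mz); case: (g) @w => v m /=; by rewrite sd_mulE /= subrr.
have wE : affine_form (w, 0) = affine_form g.
  have := affine_formM g (z, - g.2); rewrite Mz mulr0 addr0 => <-.
  by rewrite /w; case: (g) => v m /=; rewrite sd_mulE subrr.
pose r := nat_of_ord (affine_form h / affine_form g).
have Kr : K (w *+ r, 0).
  elim: (r) => [|i IH]; first exact: K1.
  by rewrite mulrS; exact: (subgroup_add sK).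
have hr : affine_form (w *+ r, 0) = affine_form h.
  have := wE; rewrite /affine_form /= cocycle0 !addr0 => wE'.
  rewrite -[RHS](mulfVK (_ : affine_form g != 0)); last exact/eqP.
  have -> : u *m bar (w *+ r) = (u *m bar w) *+ r.
    elim: (r) => [|i IH]; first by rewrite !mulr0n map_mx0 mulmx0.
    by rewrite !mulrS map_mxD mulmxDr IH.
  by rewrite mulmxnE wE' -mulr_natl natr_Zp.
rewrite -[h](mulVKg ((w *+ r, 0) : T)); apply: KMl => //; apply: MK.
by apply/lb.1.
Qed.

End Subgroup.

(** The translations of the subgroup are the kernel of [u], which determines [u] up to a
    scalar, and the [j]-th entry fixes the scalar. Then [l] is the eigenvalue of [u], and
    [c] is read off at an element of height one. *)
Lemma affine_subgroup_inj l c u l' c' u' j :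
  u != 0 -> u *m Ab = l *: u -> u' != 0 -> u' *m Ab = l' *: u' ->
  affine_subgroup l c u = affine_subgroup l' c' u' :> set T ->
  u 0 j != 0 -> u' 0 j != 0 /\ (u 0 j = u' 0 j -> (l, (u, c)) = (l', (u', c'))).
Proof.
move=> u0 ul u'0 ul' e uj.
have ker v : (u *m bar v) 0 0 = 0 -> (u' *m bar v) 0 0 = 0.
  move=> uv; have : affine_subgroup l c u ((v, 0) : T).
    by rewrite /affine_subgroup /= /affine_form uv cocycle0 addr0.
  by rewrite e /affine_subgroup /= /affine_form /= cocycle0 addr0.
have prop i : u 0 j * u' 0 i = u 0 i * u' 0 j.
  pose y : 'cV[F]_k.+1 := u 0 j *: delta_mx i 0 - u 0 i *: delta_mx j 0.
  have yE (z : 'rV[F]_k.+1) : (z *m y) 0 0 = u 0 j * z 0 i - u 0 i * z 0 j.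
    by rewrite /y mulmxBr -!scalemxAr -!colE !mxE.
  have := ker (lift_Fp y); rewrite lift_FpK !yE mulrC subrr => /(_ erefl)/eqP.
  by rewrite subr_eq0 => /eqP.
split=> [|uu].
  apply: contraNneq u'0 => u'j; apply/eqP/rowP=> i; rewrite mxE; apply/eqP.
  by have /eqP := prop i; rewrite u'j mulr0 mulf_eq0 (negPf uj).
have uE : u = u'.
  by apply/rowP=> i; apply: (mulfI uj); rewrite prop -uu mulrC.
rewrite -uE in ul' *; congr (_, (_, _)).
  by move: ul'; rewrite ul => /matrixP/(_ 0 j); rewrite !mxE => /(mulIf uj).
have [v vE] := functional_surj (- c) u0.
have : affine_subgroup l c u ((v, 1) : T) by rewrite /affine_subgroup /= /affine_form vE cocycle1 addNr.
rewrite e -uE /affine_subgroup /= /affine_form vE cocycle1 addrC => /eqP.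
by rewrite subr_eq0 eq_sym => /eqP.
Qed.
End Eigen.

Section EigenCount.
Variables (k : nat) (A : 'M[int]_k.+1) (uA : A \in unitmx) (p : nat).
Hypothesis p_pr : prime p.
Local Notation T := (semidirectZ uA).
Local Notation F := 'F_p.
Local Notation Ab := (map_mx intr A : 'M[F]_k.+1).

Definition eigenvector l : pred 'rV[F]_k.+1 := fun u => (u != 0) && (u *m Ab == l *: u).

(** At a position [j] where one of these eigenvectors is nonzero, all are, and their
    [j]-th entry determines the triple. *)
Lemma affine_fibre (M : set T) (rs : seq F) :
  (#|[pred t : F * ('rV[F]_k.+1 * F) | [&& t.1 \in rs, eigenvector t.1 t.2.1
      & `[< affine_subgroup t.1 t.2.2 t.2.1 = M >]]]| <= p.-1)%N.
Proof.
set P := [pred t | _].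
case: (pickP P) => [[l0 [u0 c0]] /and3P[_ /andP[/= u00 /eqP ul0] /asboolP M0]|P0]; last by rewrite eq_card0.
have /rV0Pn[j uj] := u00.
have nz t : P t -> t.2.1 0 j != 0.
  case: t => l [u c] /and3P[_ /andP[/= u1 /eqP ul] /asboolP M1].
  by have [] := affine_subgroup_inj u00 ul0 u1 ul (etrans M0 (esym M1)) uj.
have inj : {in P &, injective (fun t : F * ('rV[F]_k.+1 * F) => t.2.1 0 j)}.
  move=> [l [u c]] [l' [u' c']] Pt Pt'; have := nz _ Pt; move: Pt Pt'.
  move=> /and3P[_ /andP[/= u1 /eqP ul] /asboolP M1] /and3P[_ /andP[/= u1' /eqP ul'] /asboolP M1'] uj' /= e.
  by have [_ ->] := affine_subgroup_inj u1 ul u1' ul' (etrans M1 (esym M1')) uj'.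
rewrite -[X in X.-1](card_Fp p_pr) -(cardC1 (0 : F)) -(card_in_image inj).
by apply/subset_leq_card/fintype.subsetP => _ /fintype.imageP[t /nz tj ->].
Qed.

Lemma affine_count (rs : seq F) (e : nat) (s : seq (set T)) : uniq rs ->
  (forall l, l \in rs -> #|eigenvector l| = e) ->
  (forall M, maximal_subgroups p M -> M \in s) ->
  (size rs * (e * p) <= size s * p.-1)%N.
Proof.
move=> urs Hrs Hs.
pose P : pred (F * ('rV[F]_k.+1 * F)) := [pred t | (t.1 \in rs) && eigenvector t.1 t.2.1].
have -> : (size rs * (e * p))%N = #|P|.
  rewrite -sum1_card -(pair_big_dep [in rs] (fun l uc => eigenvector l uc.1) (fun _ _ => 1%N)) /=.
  rewrite -(card_uniqP urs) -sum_nat_const; apply: eq_bigr => l lrs.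
  rewrite sum1_card -(Hrs l lrs); transitivity (#|eigenvector l| * #|F|)%N.
    by rewrite card_Fp.
  by rewrite -cardX; apply: eq_card => -[u c]; rewrite !finset.inE andbT.
apply: leq_trans (card_cover (s := s)
  (r := fun M => [pred t : F * ('rV[F]_k.+1 * F) | [&& t.1 \in rs, eigenvector t.1 t.2.1
      & `[< affine_subgroup t.1 t.2.2 t.2.1 = M >]]]) _) _.
  move=> [l [u c]] /andP[/= lrs ul]; apply/hasP; exists (affine_subgroup l c u).
    by have /andP[u0 /eqP uE] := ul; apply/Hs/affine_maximal.
  by rewrite /= lrs ul; apply/asboolP.
rewrite -sum1_size big_distrl /=; apply: leq_sum => M _; rewrite mul1n.
exact: affine_fibre.
Qed.
End EigenCount.

Section Lower.
Variables (R : realType) (k : nat) (A : 'M[int]_k.+1) (uA : A \in unitmx).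
Variables (a : seq {poly rat}) (ha : rational_canonical_form (map_mx intr A) a).
Local Notation T := (semidirectZ uA).
Let rho := nb_distinct_roots R (char_poly (companionmx a`_0)).

Lemma lower_bound (N : nat) : exists n, (N <= n)%N /\
  (rho * n ^ size a <= nb_maximal_subgroups T n)%N.
Proof.
have a0 := invariant_factors_nonempty ha.
have first_dvd (i : 'I_(size a)) : a`_0 %| a`_i by apply: (invariant_factor_dvdp ha); rewrite leq0n ltn_ord.
have [N0 HN] := large_and (card_reduced_kernel ha)
  (large_forall (fun i : 'I_(size a) => large_dvdp (first_dvd i))).
have m0 := invariant_factor_monic ha a0.
have [p [p_pr pN] [rs [urs srs] /allP rsP]] := infinitely_many_split_primes (maxn N N0) (monic_neq0 m0).
move: pN; rewrite gtn_max => /andP[pN pN0]; exists p; split; first exact: ltnW.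
have [KC chain] := HN p p_pr pN0.
have [s [us <-] sE] := nb_maximal_seq uA p.
have srs' : size rs = rho by apply: succn_inj; rewrite srs -(rho_radical R ha).
have eig l : l \in rs -> #|eigenvector A l| = (p ^ size a).-1.
  move=> /rsP rl; have := KC ('X - l%:P) (monicXsubC l) (irredp_XsubC l).
  rewrite size_XsubC mul1n (cardsD1 0) finset.inE mul0mx eqxx add1n.
  have -> : #|[pred i : 'I_(size a) | ('X - l%:P %| map_poly ratr a`_i)%R]| = size a.
    rewrite -[RHS]card_ord; apply: eq_card => i; rewrite finset.inE /=.
    apply: dvdp_trans (chain i); by rewrite dvdp_XsubCl.
  move=> <-; apply: eq_card => u; rewrite !finset.inE /=; congr (_ && _).
  by rewrite rmorphB /= horner_mx_X horner_mx_C mulmxBr mul_mx_scalar subr_eq0.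
have := affine_count p_pr urs eig (fun M => (sE M).2); rewrite srs' => H.
have p1 : (0 < p.-1)%N by rewrite -subn1 subn_gt0 prime_gt1.
(* This is [p ^ b * (p - 1) <= (p ^ b - 1) * p], where [b] is the size of [a]. *)
rewrite -(leq_pmul2r p1); apply: leq_trans H; rewrite -mulnA leq_mul2l; apply/orP; right.
rewrite -!subn1 mulnBr mulnBl muln1 mul1n leq_sub2l //.
by rewrite -[X in (X <= _)%N]expn1 leq_pexp2l // prime_gt0.
Qed.
End Lower.

Theorem corollary74 (R : realType) (k : nat)
    (A : 'M[int]_k.+1) (uA : A \in unitmx)
    (a : seq {poly rat}) (ha : rational_canonical_form (map_mx intr A) a) :
  let m n := nb_maximal_subgroups (semidirectZ uA) n in
  let b := size a in
  let rho1 := nb_distinct_roots R (char_poly (companionmx a`_0)) in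
  (exists C N : nat, forall n : nat, (N <= n)%N ->
     (m n <= rho1 * n ^ b + C * n ^ (b - 1))%N) /\
  (forall N : nat, exists n : nat, (N <= n)%N /\ (rho1 * n ^ b <= m n)%N).
Proof.
by split; [exact: upper_bound | exact: lower_bound].
Qed.
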